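(* Let $1\le i\le d$, let $q\ge 2$ be an integer, and let $f(p,q)$ be the limiting pressure of the $i$-dimensional plaquette random-cluster model on $\mathbb{Z}^d$ with coefficients in $\mathbb{Z}_q$. Suppose $f(p,q)$ is differentiable as a function of $p\in(0,1)$ at $p=p_0$. Then there is a unique infinite volume ($i$-dimensional) plaquette random-cluster measure on $\mathbb{Z}^d$ with parameters $p_0,q$.
   Context: $\mathbb{Z}^d$ denotes the cubical complex on $\mathbb{R}^d$ whose $k$-cells are the $k$-dimensional unit cubes with integer corner points. For a subcomplex $X$, $X^{(k)}$ is the union of its cells of dimension at most $k$; $|X^{(i)}|$ denotes the number of $i$-cells ($i$-plaquettes) of $X$. An $i$-dimensional percolation subcomplex $P$ of $X$ is a subcomplex with $X^{(i-1)}\subset P\subset X^{(i)}$; $|P|$ is its number of $i$-plaquettes. Boxes: for integers $a_k<b_k$, the box $r=\prod_{k=1}^d[a_k,b_k]$, viewed as a complex (for the given $i$), is the union of all cells of dimension at most $i-1$ contained in it and the $i$-cells contained in it that meet its interior. Boundary conditions: for a set $\xi$ of $i$-plaquettes of $\mathbb{Z}^d$ and a percolation subcomplex $P$ of a box $r$, put $P_\xi=P\cup\{\text{plaquettes of }\xi\text{ not in }r\}\cup(\mathbb{Z}^d)^{(i-1)}$, let $\phi:P\to P_\xi$ be the inclusion and $\phi^*:H^{i-1}(P_\xi;\mathbb{Z}_q)\to H^{i-1}(P;\mathbb{Z}_q)$ the induced map, $\mathbb{Z}_q=\mathbb{Z}/q\mathbb{Z}$. Then $$\mu^{\xi}_{r,p,q,i}(P)=\frac{1}{Z^{\xi}_{r,p,q}}\,p^{|P|}(1-p)^{|r^{(i)}|-|P|}\,|\mathrm{im}\,\phi^*|,$$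 where $Z^\xi_{r,p,q}$ is the normalizing constant. Pressure: $f^{\xi}_r(p,q)=\frac{1}{|r^{(i)}|}\log Y^{\xi}_{r,p,q}$ with $Y^{\xi}_{r,p,q}=(1-p)^{-|r^{(i)}|}Z^{\xi}_{r,p,q}$. For $p\in(0,1)$, $f(p,q)=\lim_{k\to\infty}f^{\xi}_{r_k}(p,q)$ for an increasing sequence of boxes $r_k$ with union $\mathbb{Z}^d$; this limit exists and does not depend on the sequence $\{r_k\}$ or on $\xi$. An infinite volume plaquette random-cluster measure with parameters $p,q$ is a probability measure on $i$-dimensional percolation subcomplexes of $\mathbb{Z}^d$ that is a weak limit of measures on boxes exhausting $\mathbb{Z}^d$ with boundary conditions, i.e. a weak limit of $\mu^{\xi_k}_{r_k,p,q,i}$ for boxes $r_k$ increasing to $\mathbb{Z}^d$ and some boundary conditions $\xi_k$ (weak convergence: convergence of probabilities of all events depending on finitely many plaquettes). *)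

(* Defs.v *)
From mathcomp Require Import all_boot all_order all_algebra finmap.
From mathcomp Require Import all_classical all_reals all_analysis.

Set Implicit Arguments.
Unset Strict Implicit.
Unset Printing Implicit Defensive.

Import Order.TTheory GRing.Theory Num.Theory.
Import numFieldNormedType.Exports.

Local Open Scope classical_set_scope.
Local Open Scope ring_scope.

(* The pair (a, S) stands for the unit cube
     { x in R^d | a_j <= x_j <= a_j + 1 if j \in S,  x_j = a_j otherwise }. *)
Definition cell (d : nat) : Type := ({ffun 'I_d -> int} * {set 'I_d})%type.

Definition cell_dim (d : nat) (c : cell d) : nat := #|c.2|.

Definition cell_lo (d : nat) (c : cell d) (j : 'I_d) : int := c.1 j.

Definition cell_hi (d : nat) (c : cell d) (j : 'I_d) : int :=
  c.1 j + (j \in c.2)%:R.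

Definition back_face (d : nat) (c : cell d) (j : 'I_d) : cell d :=
  (c.1, c.2 :\ j)%SET.

Definition front_face (d : nat) (c : cell d) (j : 'I_d) : cell d :=
  ([ffun l => c.1 l + (l == j)%:R], c.2 :\ j)%SET.

Definition plaquette (d i : nat) : Type := {c : cell d | cell_dim c == i}.

(* Cellular cohomology with coefficients in Z/q; recall that 'Z_q is Z/q only
   for q >= 2. A k-cochain of X is extended by 0 to the cells that are not
   k-cells of X; infinitely many values may be nonzero when X is infinite. *)
Definition cochains (d q : nat) (X : set (cell d)) (k : nat) :
    set (cell d -> 'Z_q) :=
  [set f | forall c, ~ (X c /\ cell_dim c = k) -> f c = 0].

Definition restrict_to (d q : nat) (X : set (cell d)) (f : cell d -> 'Z_q) :
  cell d -> 'Z_q := patch (cst 0) X f.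

(* Dual to the boundary of a cube, which is the sum over its directions j of
   (-1)^(rank of j among the directions) (front_face j - back_face j). *)
Definition coboundary (d q : nat) (X : set (cell d)) (f : cell d -> 'Z_q) :
    cell d -> 'Z_q :=
  restrict_to X (fun c =>
    \sum_(j in c.2) (-1) ^+ #|[set l in c.2 | (l < j)%N]%SET| *
      (f (front_face c j) - f (back_face c j))).

Definition cocycles (d q : nat) (X : set (cell d)) (k : nat) :
    set (cell d -> 'Z_q) :=
  [set f | cochains X k f /\ coboundary X f = cst 0].

Definition coboundaries (d q : nat) (X : set (cell d)) (k : nat) :
    set (cell d -> 'Z_q) :=
  if k is k'.+1 then coboundary X @` cochains X k' else [set cst 0].

Definition coclass (d q : nat) (X : set (cell d)) (k : nat)
    (z : cell d -> 'Z_q) : set (cell d -> 'Z_q) :=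
  [set z + b | b in coboundaries X k].

(* The elements of H^k(X; Z/q) are the cosets of the coboundaries in the
   cocycles; in degree 0 this is the unreduced cohomology. *)
Definition cohomology (d q : nat) (X : set (cell d)) (k : nat) :
    set (set (cell d -> 'Z_q)) :=
  coclass X k @` cocycles X k.

(* The map H^k(Y; Z/q) -> H^k(X; Z/q) induced by an inclusion of X in Y; on a
   class A of Y the union below is a single class of X. *)
Definition pullback (d q : nat) (X : set (cell d)) (k : nat)
    (A : set (cell d -> 'Z_q)) : set (cell d -> 'Z_q) :=
  \bigcup_(z in A) coclass X k (restrict_to X z).

Definition im_pullback (d q : nat) (X Y : set (cell d)) (k : nat) :
    set (set (cell d -> 'Z_q)) :=
  pullback X k @` cohomology Y k.

Record box (d : nat) := Box {
  box_lo : 'I_d -> int;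
  box_hi : 'I_d -> int;
  box_ltP : forall j, box_lo j < box_hi j }.

Definition cell_in_box (d : nat) (r : box d) (c : cell d) : Prop :=
  forall j, box_lo r j <= cell_lo c j /\ cell_hi c j <= box_hi r j.

(* A product of closed intervals [l_j, u_j] meets the product of the nonempty
   open intervals ]a_j, b_j[ iff l_j < b_j and a_j < u_j for every j. *)
Definition meets_interior (d : nat) (r : box d) (c : cell d) : Prop :=
  forall j, cell_lo c j < box_hi r j /\ box_lo r j < cell_hi c j.

(* The i-cells of the box regarded as a complex; this is a finite set. *)
Definition box_plaquettes (d i : nat) (r : box d) : {fset plaquette d i} :=
  fset_set [set e : plaquette d i |
    cell_in_box r (val e) /\ meets_interior r (val e)].

Definition exhausting (d : nat) (r : nat -> box d) : Prop :=
  (forall k, cell_in_box (r k) `<=` cell_in_box (r k.+1)) /\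
  \bigcup_k cell_in_box (r k) = setT.

(* A percolation subcomplex of X contains all the cells of X of dimension less
   than i, so it is encoded by the set of its i-plaquettes: a finite subset of
   box_plaquettes i r for a box r, an arbitrary set for Z^d. *)

Definition box_complex (d i : nat) (r : box d) (P : {fset plaquette d i}) :
    set (cell d) :=
  [set c | cell_in_box r c /\ (cell_dim c < i)%N] `|` val @` [set` P].

Definition bc_complex (d i : nat) (r : box d) (xi : set (plaquette d i))
    (P : {fset plaquette d i}) : set (cell d) :=
  box_complex r P `|` val @` (xi `\` [set` box_plaquettes i r])
    `|` [set c | (cell_dim c < i)%N].

Definition im_card (d i q : nat) (r : box d) (xi : set (plaquette d i))
    (P : {fset plaquette d i}) : nat :=
  #|` fset_set (im_pullback (q := q)
        (box_complex r P) (bc_complex r xi P) i.-1)|.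

Definition prc_weight (R : realType) (d i q : nat) (p : R) (r : box d)
    (xi : set (plaquette d i)) (P : {fset plaquette d i}) : R :=
  p ^+ #|` P| * (1 - p) ^+ (#|` box_plaquettes i r| - #|` P|)%N
    * (im_card q r xi P)%:R.

Definition prc_partition (R : realType) (d i q : nat) (p : R) (r : box d)
    (xi : set (plaquette d i)) : R :=
  \sum_(P <- fpowerset (box_plaquettes i r)) prc_weight q p r xi P.

Definition prc (R : realType) (d i q : nat) (p : R) (r : box d)
    (xi : set (plaquette d i)) (P : {fset plaquette d i}) : R :=
  prc_weight q p r xi P / prc_partition q p r xi.

Definition box_pressure (R : realType) (d i q : nat) (p : R) (r : box d)
    (xi : set (plaquette d i)) : R :=
  (#|` box_plaquettes i r|%:R)^-1 *
    ln ((1 - p) ^- #|` box_plaquettes i r| * prc_partition q p r xi).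

Definition open_events (d i : nat) : set (set (set (plaquette d i))) :=
  [set A | exists e : plaquette d i, A = [set w | w e]].

(* Percolation subcomplexes of Z^d with the product sigma-algebra. *)
Definition config (d i : nat) : Type := g_sigma_algebraType (@open_events d i).

Definition local_event (d i : nat) (A : set (set (plaquette d i))) : Prop :=
  exists F : {fset plaquette d i}, forall w w' : set (plaquette d i),
    (forall e, e \in F -> (w e <-> w' e)) -> (A w <-> A w').

(* Plaquettes outside of the box are taken to be absent from w; this is
   immaterial for the limits below, since a local event only depends on
   plaquettes of the box as soon as the box is large enough. *)
Definition prc_prob (R : realType) (d i q : nat) (p : R) (r : box d)
    (xi : set (plaquette d i)) (A : set (set (plaquette d i))) : R :=
  \sum_(P <- fpowerset (box_plaquettes i r) | `[< A [set` P] >])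
    prc q p r xi P.

Definition infinite_volume_prc (R : realType) (d i q : nat) (p : R)
    (mu : probability (config d i) R) : Prop :=
  exists (r : nat -> box d) (xi : nat -> set (plaquette d i)),
    exhausting r /\
    forall A : set (set (plaquette d i)), local_event A ->
      (fun k => (prc_prob q p (r k) (xi k) A)%:E) @ \oo --> mu A.

(* f is the limit along some exhausting sequence of boxes, with some boundary
   condition; its independence of these choices is not assumed. The values of
   f outside ]0, 1[ are irrelevant. *)
Definition limiting_pressure (R : realType) (d i q : nat) (f : R -> R) : Prop :=
  exists (r : nat -> box d) (xi : set (plaquette d i)), exhausting r /\
    forall p : R, 0 < p < 1 ->
      (fun k => box_pressure q p (r k) xi) @ \oo --> f p.

(* Main.v *)
(* In a box r, let N(P) be the number of (i-1)-cochains on r that extend to a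
   cochain of Z^d closed on P and on the plaquettes of xi outside of r.
   Since N(P) = |im phi^*| |B^{i-1}(r)|, the weights are proportional to
   x^|P| N(P) with x = p/(1-p). Inequalities between indices of subgroups of
   cochains give the hypothesis of the four functions theorem, hence, for boxes
   r included in r', the free measure on r is dominated by any measure on r',
   which on r is dominated by the wired measure on r.

   Free and wired pressures differ by at most the entropy of the (i-1)-cells of
   the boundary of r, so both converge to f. The log-partition functions are
   convex in log x with slope the mean number of open plaquettes, so that, at a
   point of differentiability, the density gap
     gap_r(e) = wired_r(e open) - free_r(e open) >= 0
   averaged over the plaquettes e of r tends to 0. It is invariant under
   translation and nonincreasing in r, so it tends to 0 for each e. For an event
   A depending on a finite set F of plaquettes, sum_{e in F} 1_e +- 1_A is
   increasing; hence, for every boundary condition on a larger box, the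
   probability of A differs from the free one on r by at most
   sum_{e in F} gap_r(e), and all limits agree. *)

From HB Require Import structures.
Require Import Defs.
From mathcomp Require Import all_boot all_order all_algebra finmap.
From mathcomp Require Import all_classical all_reals all_analysis.
From mathcomp Require Import measurable_realfun.
From mathcomp Require Import ring lra zify.

Set Implicit Arguments.
Unset Strict Implicit.
Unset Printing Implicit Defensive.

Import Order.TTheory GRing.Theory Num.Theory.
Import numFieldNormedType.Exports.

Local Open Scope classical_set_scope.
Local Open Scope ring_scope.

(** * Cardinalities of finite sets and indices *)

(** What N(P) gains over cohomology: for a given box it counts elements of a subgroup of one finite
    group, the functions on the (i-1)-cells of the box, so different configurations, boxes and
    boundary conditions are compared by restricting or extending functions. Boxes of any shape
    occur; exhaustion forces every side to infinity, which makes the boundary negligible. No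
    derivative of a log-partition function is taken. Tangent-line inequalities at x e^t and x e^-t
    bound t times the summed gap by a symmetric second difference, and differentiability of f makes
    this o(t); a single t, fixed before the box, suffices. Translation is used across boxes: a gap
    at e of at least eps in every box around e would recur at all parallel plaquettes of a box, a
    positive fraction of its plaquettes. That all limits agree does not yet give a measure: the
    limits form a finitely additive function of local events. It is realised by handing the bits of
    a random point of [0, 1[ to the plaquettes, so that countable additivity is inherited from
    Lebesgue measure. *)

Lemma fset_set_card_inj (T U : choiceType) (A : set T) (B : set U)
    (f : T -> U) : finite_set B -> (forall x, A x -> B (f x)) ->
    (forall x y, A x -> A y -> f x = f y -> x = y) ->
  finite_set A /\ (#|` fset_set A| <= #|` fset_set B|)%N.
Proof.
move=> finB AB finj.
have finjA : {in A &, injective f}.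
  by move=> x y /set_mem Ax /set_mem Ay; apply: finj.
have sub : f @` A `<=` B by move=> _ [x Ax <-]; apply: AB.
have finfA : finite_set (f @` A) by apply: sub_finite_set finB.
have finA : finite_set A.
  by rewrite -(eq_finite_set (inj_card_eq finjA)).
split=> //.
have -> : #|` fset_set A| = #|` fset_set (f @` A)|.
  apply/fcard_eq => //.
  by rewrite card_eq_sym; apply: inj_card_eq.
by apply: fsubset_leq_card; rewrite -fset_set_sub.
Qed.

Lemma fset_set_cardX (T U : choiceType) (A : set T) (B : set U) :
  finite_set A -> finite_set B ->
  #|` fset_set (A `*` B)| = (#|` fset_set A| * #|` fset_set B|)%N.
Proof.
move=> finA finB; rewrite fset_setX //.
pose s := [seq (x, y) | x <- fset_set A, y <- fset_set B].
rewrite -(size_allpairs (@pair T U)).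
set X := (_ `*` _)%fset.
suff : perm_eq X s by move=> /perm_size ->.
apply: uniq_perm; first exact: fset_uniq.
  by apply: allpairs_uniq => // -[? ?] [? ?].
move=> [x y]; rewrite in_fsetM /=; apply/andP/allpairsP => [[xA yB]|].
  by exists (x, y).
by move=> [[x' y'] /= [xA yB [-> ->]]].
Qed.

Lemma fset_set_card_image (T U : choiceType) (A : set T) (f : T -> U) :
    finite_set A -> (forall x y, A x -> A y -> f x = f y -> x = y) ->
  #|` fset_set (f @` A)| = #|` fset_set A|.
Proof.
move=> finA finj; apply/fcard_eq => //; first exact: finite_image.
by apply: inj_card_eq => x y /set_mem Ax /set_mem Ay; apply: finj.
Qed.

(* The index inequality [A : A'] <= [B : B'], cross-multiplied; phi need not be
   a morphism. *)
Lemma card_index_le (T U : zmodType) (A A' : set T) (B B' : set U)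
    (phi : T -> U) :
    finite_set A' -> finite_set B ->
    (forall x y, B x -> B' y -> B (x + y)) ->
    (forall u, A u -> B (phi u)) ->
    (forall x y, B' x -> B' y -> B' (x - y)) ->
    (forall u v, A u -> A v -> B' (phi u - phi v) -> A' (u - v)) ->
    B' `<=` B -> finite_set A ->
  (#|` fset_set A| * #|` fset_set B'| <= #|` fset_set A'| * #|` fset_set B|)%N.
Proof.
move=> finA' finB BD phiB B'B phiA' sub finA.
have finB' : finite_set B' by apply: sub_finite_set finB.
(* A representative that depends only on [y]: some [u] in [A] whose image lies in the [B']-coset of
   [y]. *)
pose rep (y : U) : T := xget 0 [set u | A u /\ B' (y - phi u)].
have repP u y : A u -> B' (y - phi u) -> A (rep y) /\ B' (y - phi (rep y)).
  by move=> Au yu; apply: (xgetPex 0 (P := [set u | A u /\ B' (y - phi u)]));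
    exists u.
rewrite -!fset_set_cardX //.
(* An injection of [A * B'] into [A' * B]. The second coordinate [y] determines [rep y], so the
   first one gives back [u], and then [y] gives back the element of [B']. *)
pose F (z : T * U) := (z.1 - rep (phi z.1 + z.2), phi z.1 + z.2).
apply: (proj2 (@fset_set_card_inj _ _ _ _ F _ _ _)).
- exact: finite_setX.
- move=> [u b] [/= Au B'b]; split=> /=; last by apply: BD => //; apply: phiB.
  have [Ar yr] : A (rep (phi u + b)) /\ B' (phi u + b - phi (rep (phi u + b))).
    by apply: (repP u) => //; rewrite addrAC subrr add0r.
  apply: phiA' => //.
  have -> : phi u - phi (rep (phi u + b)) =
    (phi u + b - phi (rep (phi u + b))) - b by rewrite (addrAC (phi u) b) addrK.
  exact: B'B.
- move=> [u b] [u' b'] [/= Au B'b] [/= Au' B'b'] [eq1 eq2].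
  have eu : u = u' by move: eq1; rewrite -eq2 => /addIr.
  by move: eq2; rewrite eu => /addrI ->.
Qed.

(** Lagrange's theorem for subgroups given as sets: every element of [W] is, in exactly one way, the
    chosen representative of its coset plus an element of [B]. *)
Lemma card_cosets (T : zmodType) (W B : set T) :
    finite_set W -> B `<=` W -> B 0 ->
    (forall x y, W x -> W y -> W (x - y)) ->
    (forall x y, B x -> B y -> B (x - y)) ->
  (#|` fset_set ((fun w => [set (w + b)%R | b in B]) @` W)| *
    #|` fset_set B|)%N = #|` fset_set W|.
Proof.
move=> finW BW B0 Wsub Bsub.
pose cs w := [set w + b | b in B].
have finB : finite_set B by apply: sub_finite_set finW.
have finC : finite_set (cs @` W) by apply: finite_image.
have BN x : B x -> B (- x) by move=> Bx; rewrite -sub0r; apply: Bsub.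
have WN x : W x -> W (- x).
  by move=> Wx; rewrite -sub0r; apply: Wsub => //; apply: BW.
have WD x y : W x -> W y -> W (x + y).
  by move=> Wx Wy; rewrite -[y]opprK; apply: Wsub => //; apply: WN.
have csE u v : cs u = cs v -> B (u - v).
  move=> e; have : cs u u by exists 0 => //; rewrite addr0.
  by rewrite e => -[b Bb <-]; rewrite addrC addKr.
have csE' u v : B (u - v) -> cs u = cs v.
  move=> Buv; apply/seteqP; split=> _ [b Bb <-].
    exists (u - v + b); last by rewrite addrA (addrC v) subrK.
    by rewrite -[b]opprK; apply: Bsub => //; apply: BN.
  exists (b - (u - v)); first exact: Bsub.
  by rewrite opprB addrC -addrA subrK addrC.
rewrite -fset_set_cardX //.
pose rep (C : set T) : T := xget 0 [set u | W u /\ cs u = C].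
have repP C : (cs @` W) C -> W (rep C) /\ cs (rep C) = C.
  move=> [u Wu uC].
  by apply: (xgetPex 0 (P := [set u | W u /\ cs u = C])); exists u.
have e : (fun z : set T * T => rep z.1 + z.2) @` ((cs @` W) `*` B) = W.
  apply/seteqP; split=> [_ [[C b] [/= /repP[Wr _] Bb] <-]|w Ww].
    by apply: WD => //; apply: BW.
  have [Wr er] : W (rep (cs w)) /\ cs (rep (cs w)) = cs w.
    by apply: repP; exists w.
  exists (cs w, w - rep (cs w)) => /=; last by rewrite addrC subrK.
  by split=> /=; [exists w|apply: csE].
rewrite -[X in _ = #|` fset_set X|]e.
apply/esym/fset_set_card_image; first exact: finite_setX.
move=> [C b] [C' b'] [/= /repP[Wr er] Bb] [/= /repP[Wr' er'] Bb'] ez.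
have eC : C = C'.
  rewrite -er -er'; apply: csE'.
  have -> : rep C - rep C' = b' - b.
    by apply/eqP; rewrite subr_eq addrAC -subr_eq opprK ez addrC.
  exact: Bsub.
by move: ez; rewrite eC => /addrI ->.
Qed.

(** * Correlation inequalities *)

Lemma sum_fpowersetU1 (K : choiceType) (V : nmodType) (x : K) (E : {fset K})
    (F : {fset K} -> V) : x \notin E ->
  \sum_(P <- fpowerset (x |` E)%fset) F P =
  \sum_(P <- fpowerset E) (F P + F (x |` P)%fset).
Proof.
move=> xE; rewrite big_split /= -[X in _ = _ + X](big_map (fun P =>
  x |` P)%fset xpredT F).
rewrite -big_cat; apply: perm_big; apply: uniq_perm; first exact: fset_uniq.
  rewrite cat_uniq fset_uniq map_inj_in_uniq ?fset_uniq ?andbT /=.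
    apply/hasPn => _ /mapP[P _ ->]; apply: contra xE; rewrite fpowersetE.
    by move=> /fsubsetP; apply; rewrite fset1U1.
  move=> P Q; rewrite !fpowersetE => /fsubsetP PE /fsubsetP QE e.
  have xP : x \notin P by apply: contra xE; apply: PE.
  have xQ : x \notin Q by apply: contra xE; apply: QE.
  by rewrite -(fsetU1K xP) -(fsetU1K xQ) e.
move=> P; rewrite mem_cat !fpowersetE; apply/idP/orP => [PE|[PE|/mapP[Q]]].
- have [xP|xP] := boolP (x \in P); [right|left].
    apply/mapP; exists (P `\ x)%fset; last by rewrite fsetD1K.
    by rewrite fpowersetE fsubDset.
  by rewrite -(mem_fsetD1 xP) fsubDset.
- by apply: (fsubset_trans PE); apply: fsubsetU1.
- by rewrite fpowersetE => QE ->; apply: fsetUS.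
Qed.

(** The four functions theorem on a one-element set. With u = a0 b1, v = a1 b0, w = c0 d1 and z = c1
    d0, the hypotheses give u, v <= w and u v <= w z; expanding (w - u)(w - v) >= 0 yields w (u + v)
    <= w^2 + u v <= w (w + z), hence u + v <= w + z. *)
Lemma four_point_le (R : realFieldType) (a0 a1 b0 b1 c0 c1 d0 d1 : R) :
    0 <= a0 -> 0 <= a1 -> 0 <= b0 -> 0 <= b1 ->
    0 <= c0 -> 0 <= c1 -> 0 <= d0 -> 0 <= d1 ->
    a0 * b0 <= c0 * d0 -> a0 * b1 <= c0 * d1 ->
    a1 * b0 <= c0 * d1 -> a1 * b1 <= c1 * d1 ->
  (a0 + a1) * (b0 + b1) <= (c0 + c1) * (d0 + d1).
Proof.
move=> a0p a1p b0p b1p c0p c1p d0p d1p h00 h01 h10 h11.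
suff h : a0 * b1 + a1 * b0 <= c0 * d1 + c1 * d0 by nra.
have u0 : 0 <= a0 * b1 by apply: mulr_ge0.
have v0 : 0 <= a1 * b0 by apply: mulr_ge0.
have z0 : 0 <= c1 * d0 by apply: mulr_ge0.
have uv : (a0 * b1) * (a1 * b0) <= (c0 * d1) * (c1 * d0).
  have -> : (a0 * b1) * (a1 * b0) = (a0 * b0) * (a1 * b1) by ring.
  have -> : (c0 * d1) * (c1 * d0) = (c0 * d0) * (c1 * d1) by ring.
  by apply: ler_pM => //; apply: mulr_ge0.
move: u0 v0 z0 uv h01 h10.
set u := a0 * b1; set v := a1 * b0; set w := c0 * d1; set z := c1 * d0.
move=> u0 v0 z0 uv uw vw.
have [w0|w0] := leP w 0; first by lra.
rewrite -(ler_pM2l w0).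
have : 0 <= (w - u) * (w - v) by apply: mulr_ge0; rewrite subr_ge0.
by nra.
Qed.

(** Ahlswede-Daykin, by induction on [E]: for a chosen [x] in [E], each function is replaced by the
    sum of its values at [P] without and with [x], and [four_point_le] transfers the hypothesis to
    these sums. *)
Lemma four_functions (K : choiceType) (R : realFieldType) (E : {fset K})
    (a b c d : {fset K} -> R) :
    (forall P, 0 <= a P) -> (forall P, 0 <= b P) ->
    (forall P, 0 <= c P) -> (forall P, 0 <= d P) ->
    (forall P Q, (P `<=` E)%fset -> (Q `<=` E)%fset ->
      a P * b Q <= c (P `&` Q)%fset * d (P `|` Q)%fset) ->
  (\sum_(P <- fpowerset E) a P) * (\sum_(P <- fpowerset E) b P) <=
  (\sum_(P <- fpowerset E) c P) * (\sum_(P <- fpowerset E) d P).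
Proof.
have [n] := ubnP #|` E|; elim: n E a b c d => // n IH E a b c d.
have [->|[x xE]] := fset_0Vmem E.
  move=> _ _ _ _ _ h; rewrite fpowerset0 !big_seq_fset1.
  by have := h fset0 fset0 (fsubset_refl _) (fsubset_refl _);
    rewrite fsetI0 fsetU0.
rewrite (cardfsD1 x) xE ltnS => En a0 b0 c0 d0 h.
have xE' : x \notin (E `\ x)%fset by rewrite !inE eqxx.
have e : (x |` (E `\ x) = E)%fset by rewrite fsetD1K.
rewrite -e !sum_fpowersetU1 //.
apply: (IH _ (fun P => a P + a (x |` P)%fset) (fun P => b P + b (x |` P)%fset)
  (fun P => c P + c (x |` P)%fset) (fun P => d P + d (x |` P)%fset)) => //;
  try by move=> P; apply: addr_ge0.
move=> P Q PE QE.
have xP : x \notin P by apply: contra xE'; apply: (fsubsetP PE).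
have xQ : x \notin Q by apply: contra xE'; apply: (fsubsetP QE).
have UE A : (A `<=` E `\ x)%fset -> (A `<=` E)%fset /\ ((x |` A) `<=` E)%fset.
  move=> AE; split; last by rewrite -e; apply: fsetUS.
  by apply: (fsubset_trans AE); apply: fsubD1set.
have [PE0 PE1] := UE _ PE; have [QE0 QE1] := UE _ QE.
apply: four_point_le => //.
- exact: h.
- have := h _ _ PE0 QE1; congr (_ <= c _ * d _).
    by apply/fsetP => y; rewrite !inE; case: eqP => // ->; rewrite (negbTE xP).
  by rewrite fsetUCA.
- have := h _ _ PE1 QE0; congr (_ <= c _ * d _).
    by apply/fsetP => y; rewrite !inE; case: eqP => // ->;
      rewrite (negbTE xQ) (negbTE xP).
  by rewrite fsetUA.
- have := h _ _ PE1 QE1; congr (_ <= c _ * d _).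
    by rewrite -fsetUIr.
  by rewrite fsetUACA fsetUid.
Qed.

(** The four functions theorem for [m1 * phi], [m2], [m1] and [m2 * phi], since [phi P] is at most
    [phi] of the union. The cross-multiplied form leaves the two measures unnormalized. *)
Lemma holley (K : choiceType) (R : realFieldType) (E : {fset K})
    (m1 m2 phi : {fset K} -> R) :
    (forall P, 0 <= m1 P) -> (forall P, 0 <= m2 P) -> (forall P, 0 <= phi P) ->
    (forall P Q, (P `<=` Q)%fset -> phi P <= phi Q) ->
    (forall P Q, (P `<=` E)%fset -> (Q `<=` E)%fset ->
      m1 P * m2 Q <= m1 (P `&` Q)%fset * m2 (P `|` Q)%fset) ->
  (\sum_(P <- fpowerset E) m1 P * phi P) * (\sum_(P <- fpowerset E) m2 P) <=
  (\sum_(P <- fpowerset E) m1 P) * (\sum_(P <- fpowerset E) m2 P * phi P).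
Proof.
move=> m10 m20 phi0 phiM h; apply: four_functions => //.
- by move=> P; apply: mulr_ge0.
- by move=> P; apply: mulr_ge0.
- move=> P Q PE QE; rewrite mulrAC mulrA; apply: ler_pM => //.
  + exact: mulr_ge0.
  + exact: h.
  + by apply: phiM; apply: fsubsetUl.
Qed.

(** * Cochains on boxes *)

Lemma fset_set_setT_card (T : finType) : #|` fset_set [set: T]| = #|T|.
Proof.
rewrite -card_finset; congr (#|` _|); apply/fsetP => x.
by rewrite in_fset_set ?mem_setT ?inE //; exact: finite_finset.
Qed.

Definition supported (T : Type) (V : nmodType) (A : set T) : set (T -> V) :=
  [set f | forall c, ~ A c -> f c = 0].

Lemma supported_card (T : choiceType) (V : finZmodType) (A : set T) :
    finite_set A -> finite_set (@supported T V A) /\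
  (#|` fset_set (@supported T V A)| <= #|V| ^ #|` fset_set A|)%N.
Proof.
move=> finA; set S := supported A.
pose E := fset_set A.
pose F (f : T -> V) : {ffun E -> V} := [ffun c => f (val c)].
have := @fset_set_card_inj _ _ S [set: {ffun E -> V}] F.
rewrite fset_set_setT_card card_ffun -cardfE => /(_ finite_finset) H.
apply: H => //.
move=> f g fS gS e; apply/funext => c.
have [Ac|nAc] := pselect (A c); last by rewrite fS // gS.
have cE : c \in E by rewrite in_fset_set // inE.
by move: e => /ffunP /(_ [` cE]%fset); rewrite !ffunE.
Qed.

Definition grid (d : nat) (lo hi : 'I_d -> int) : set {ffun 'I_d -> int} :=
  [set a : {ffun 'I_d -> int} | forall j, lo j <= a j <= hi j].

(** The hypothesis admits empty sides, which occur for the interior points of a box of width 1. *)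
Lemma grid_card (d : nat) (lo hi : 'I_d -> int) :
    (forall j, lo j <= hi j + 1) ->
  finite_set (grid lo hi) /\
  #|` fset_set (grid lo hi)| = (\prod_j `|(hi j - lo j + 1)%R|)%N.
Proof.
move=> lohi; pose m j := `|(hi j - lo j + 1)%R|%N.
pose F (x : {dffun forall j : 'I_d, 'I_(m j)}) : {ffun 'I_d -> int} :=
  [ffun j => lo j + (x j : nat)%:Z].
have -> : grid lo hi = F @` setT.
  apply/seteqP; split=> [a aV|_ [x _ <-] j]; last first.
    rewrite ffunE; have : (x j < `|(hi j - lo j + 1)%R|)%N := ltn_ord (x j).
    by move: (nat_of_ord _) (lohi j) => n; lia.
  have lt j : (`|(a j - lo j)%R| < m j)%N by rewrite /m; have := aV j; lia.
  exists [ffun j => Ordinal (lt j)] => //.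
  by apply/ffunP => j; rewrite !ffunE /=; have := aV j; lia.
have finT := @finite_finset _ [set: {dffun forall j : 'I_d, 'I_(m j)}].
split; first exact: finite_image.
rewrite fset_set_card_image //; last first.
  move=> x y _ _ /ffunP e; apply/ffunP => j; apply: val_inj.
  by have := e j; rewrite !ffunE /= => /addrI [].
rewrite fset_set_setT_card card_dep_ffun foldrE big_map big_enum /=.
by apply: eq_bigr => j _; rewrite card_ord.
Qed.

(** * The cubical coboundary squares to zero *)

Lemma antisym_sum0 (V : zmodType) (n : nat) (S : {set 'I_n})
    (G : 'I_n -> 'I_n -> V) :
    (forall j l, j \in S -> l \in S -> (j < l)%N -> G j l = - G l j) ->
  \sum_(j in S) \sum_(l in S :\ j) G j l = 0.
Proof.
move=> GN.
have split j : \sum_(l in S :\ j) G j l =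
    \sum_(l in S | (l < j)%N) G j l + \sum_(l in S | (j < l)%N) G j l.
  rewrite (bigID (fun l : 'I_n => (l < j)%N)) /=; congr (_ + _).
    apply: eq_bigl => l; rewrite !inE -val_eqE /=.
    by case: (l \in S); lia.
  apply: eq_bigl => l; rewrite !inE -val_eqE /=.
  by case: (l \in S); lia.
rewrite (eq_bigr _ (fun j _ => split j)). rewrite big_split /=.
rewrite [X in _ + X = _](exchange_big_dep (fun l => l \in S)) /=;
  last by move=> j l _ /andP[].
rewrite -big_split big1 // => j jS.
rewrite [X in _ + X = _](eq_bigr (fun l => - G j l)); last first.
  by move=> l /and3P[lS _ lj]; exact: GN.
rewrite sumrN [X in _ - X = _](eq_bigl (fun l =>
  (l \in S) && (l < j)%N)) ?subrr //.
by move=> l; rewrite jS.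
Qed.

(* [coboundary X f] is convertible to [restrict_to X (dcob f)]. *)
Definition dcob (d q : nat) (f : cell d -> 'Z_q) (c : cell d) : 'Z_q :=
  \sum_(j in c.2) (-1) ^+ #|[set l in c.2 | (l < j)%N]%SET| *
    (f (front_face c j) - f (back_face c j)).

Lemma dcobD (d q : nat) (f g : cell d -> 'Z_q) c :
  dcob (f + g) c = dcob f c + dcob g c.
Proof.
rewrite /dcob -big_split; apply: eq_bigr => j _ /=.
by rewrite -mulrDr !fctE opprD addrACA.
Qed.

Lemma dcobN (d q : nat) (f : cell d -> 'Z_q) c : dcob (- f) c = - dcob f c.
Proof.
rewrite /dcob -sumrN; apply: eq_bigr => j _ /=.
by rewrite -mulrN !fctE opprD.
Qed.

Lemma dcobB (d q : nat) (f g : cell d -> 'Z_q) c :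
  dcob (f - g) c = dcob f c - dcob g c.
Proof. by rewrite dcobD dcobN. Qed.

Lemma eq_dcob (d q : nat) (f g : cell d -> 'Z_q) (c : cell d) :
    (forall j, j \in c.2 -> f (front_face c j) = g (front_face c j)) ->
    (forall j, j \in c.2 -> f (back_face c j) = g (back_face c j)) ->
  dcob f c = dcob g c.
Proof. by move=> e1 e2; apply: eq_bigr => j jc; rewrite e1 // e2. Qed.

(** Taking faces in two directions commutes, whereas the signs anticommute: for j < l, removing j
    lowers the rank of l by one and removing l leaves the rank of j unchanged. The double sum is
    therefore antisymmetric. *)
Lemma dcob_dcob (d q : nat) (f : cell d -> 'Z_q) c : dcob (dcob f) c = 0.
Proof.
case: c => a S; rewrite /dcob /=.
pose s (T : {set 'I_d}) (j : 'I_d) : 'Z_q :=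
  (-1) ^+ #|[set l in T | (l < j)%N]%SET|.
pose D j l := f (front_face (front_face (a, S) j) l) -
  f (back_face (front_face (a, S) j) l)
  - (f (front_face (back_face (a, S) j) l) - f (back_face (back_face (a,
    S) j) l)).
rewrite (eq_bigr (fun j => \sum_(l in S :\ j) s S j * s (S :\ j) l * D j l));
  last first.
  move=> j jS; rewrite -sumrB mulr_sumr; apply: eq_bigr => l _.
  by rewrite -mulrBr mulrA.
apply: antisym_sum0 => j l jS lS jl.
have jl' : j != l by rewrite -val_eqE /= neq_ltn jl.
have -> : D l j = D j l.
  have faceC : front_face (front_face (a, S) l) j = front_face (front_face (a,
    S) j) l.
    congr pair; last by rewrite /= !finset.setDDl finset.setUC.
    by apply/ffunP => m; rewrite !ffunE addrAC.
  have fbC u v : front_face (back_face (a, S) u) v = back_face (front_face (a,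
    S) v) u.
    by congr pair; rewrite /= !finset.setDDl finset.setUC.
  have bbC : back_face (back_face (a, S) l) j = back_face (back_face (a,
    S) j) l.
    by congr pair; rewrite /= !finset.setDDl finset.setUC.
  rewrite /D faceC bbC !fbC.
  set x := f _; set y := f _; set z := f _; set w := f _.
  ring.
rewrite -mulNr; congr (_ * _).
have sl : s (S :\ j) l = - s S l.
  rewrite /s.
  have -> : [set m in S | (m < l)%N]%SET =
    (j |: [set m in S :\ j | (m < l)%N])%SET.
    apply/finset.setP => m; rewrite !inE; case: eqP => [->|] //=.
    by rewrite jS jl.
  by rewrite cardsU1 !inE eqxx /= exprS mulN1r opprK.
have sj : s (S :\ l) j = s S j.
  rewrite /s.
  have -> // : [set m in S :\ l | (m < j)%N]%SET = [set m in S | (m < j)%N]%SET.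
  apply/finset.setP => m; rewrite !inE.
  by case: eqP => [->|] //=; rewrite ltnNge (ltnW jl) andbF.
by rewrite sl sj; ring.
Qed.

Lemma front_face_in_box (d : nat) (r : box d) (c : cell d) (j : 'I_d) :
  j \in c.2 -> cell_in_box r c -> cell_in_box r (front_face c j).
Proof.
move=> jc rc l; have [] := rc l; rewrite /cell_lo /cell_hi /= !ffunE !inE.
by case: eqP => [->|_] /=; rewrite ?jc; lia.
Qed.

Lemma back_face_in_box (d : nat) (r : box d) (c : cell d) (j : 'I_d) :
  j \in c.2 -> cell_in_box r c -> cell_in_box r (back_face c j).
Proof.
move=> jc rc l; have [] := rc l; rewrite /cell_lo /cell_hi /= !inE.
by case: eqP => [->|_] /=; rewrite ?jc; lia.
Qed.

Lemma front_face_dim (d : nat) (c : cell d) (j : 'I_d) :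
  j \in c.2 -> cell_dim c = (cell_dim (front_face c j)).+1.
Proof. by move=> jc; rewrite /cell_dim (cardsD1 j) jc. Qed.

Lemma back_face_dim (d : nat) (c : cell d) (j : 'I_d) :
  j \in c.2 -> cell_dim c = (cell_dim (back_face c j)).+1.
Proof. by move=> jc; rewrite /cell_dim (cardsD1 j) jc. Qed.

Lemma dcob_dim0 (d q k : nat) (f : cell d -> 'Z_q) (c : cell d) :
    (forall c', cell_dim c' <> k -> f c' = 0) -> cell_dim c <> k.+1 ->
  dcob f c = 0.
Proof.
move=> f0 ck; rewrite /dcob big1 // => j jc.
rewrite !f0 ?subrr ?mulr0 //.
  by move=> e; apply: ck; rewrite (back_face_dim jc) e.
by move=> e; apply: ck; rewrite (front_face_dim jc) e.
Qed.

Lemma restrict_toT (d q : nat) (A : set (cell d)) (f : cell d -> 'Z_q) c :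
  A c -> restrict_to A f c = f c.
Proof. by move=> Ac; rewrite /restrict_to patchT // inE. Qed.

Lemma restrict_toN (d q : nat) (A : set (cell d)) (f : cell d -> 'Z_q) c :
  ~ A c -> restrict_to A f c = 0.
Proof. by move=> Ac; rewrite /restrict_to patchC // inE. Qed.

Lemma restrict_toB (d q : nat) (A : set (cell d)) (f g : cell d -> 'Z_q) :
  restrict_to A (f - g) = restrict_to A f - restrict_to A g.
Proof.
apply/funext => c; rewrite !fctE.
have [Ac|Ac] := pselect (A c); first by rewrite !restrict_toT.
by rewrite !restrict_toN // subrr.
Qed.

Lemma restrict_toD (d q : nat) (A : set (cell d)) (f g : cell d -> 'Z_q) :
  restrict_to A (f + g) = restrict_to A f + restrict_to A g.
Proof.
apply/funext => c; rewrite !fctE.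
have [Ac|Ac] := pselect (A c); first by rewrite !restrict_toT.
by rewrite !restrict_toN // addr0.
Qed.

Lemma restrict_to0 (d q : nat) (A : set (cell d)) :
  restrict_to A (0 : cell d -> 'Z_q) = 0.
Proof. by rewrite -[X in restrict_to A X](subrr 0) restrict_toB subrr. Qed.

Lemma dcob0 (d q : nat) (c : cell d) : dcob (0 : cell d -> 'Z_q) c = 0.
Proof. by rewrite -[X in dcob X](subrr 0) dcobB subrr. Qed.

(** * Closed functions on a box and the image of phi^* *)

Definition skel (d i : nat) (r : box d) : set (cell d) :=
  [set c | cell_in_box r c /\ cell_dim c = i.-1].

Definition boxpl (d i : nat) (r : box d) : set (plaquette d i) :=
  [set e | cell_in_box r (val e) /\ meets_interior r (val e)].

(** The functions are not restricted to (i-1)-cells: the condition at a plaquette only reads its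
    faces, which have dimension i-1. *)
Definition closed_on (d i q : nat) (w : set (plaquette d i)) :
    set (cell d -> 'Z_q) :=
  [set g | forall e, w e -> dcob g (val e) = 0].

(** Closedness is imposed on all of Z^d and only then is the function restricted, so plaquettes of
    [w] far from the box constrain what is seen inside. Taking for [w] the union of [P] and of the
    plaquettes of the boundary condition outside the box, the cardinality below is N(P). *)
Definition closed_on_box (d i q : nat) (r : box d) (w : set (plaquette d i)) :
    set (cell d -> 'Z_q) :=
  restrict_to (skel i r) @` @closed_on d i q w.

Definition closed_card (d i q : nat) (r : box d) (w : set (plaquette d i)) :
  nat :=
  #|` fset_set (@closed_on_box d i q r w)|.

Lemma box_finite (d : nat) (r : box d) : finite_set (cell_in_box r).
Proof.
have lohi j : box_lo r j <= box_hi r j + 1 by have := box_ltP r j; lia.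
have [finV _] := grid_card lohi.
apply: (proj1 (@fset_set_card_inj _ _ _ (grid (box_lo r) (box_hi r) `*` setT)
  (id : cell d -> {ffun 'I_d -> int} * {set 'I_d}) _ _ _)) => //.
  by apply: finite_setX => //; exact: finite_finset.
move=> c rc; split=> // j; have := rc j; rewrite /cell_lo /cell_hi.
by case: (j \in c.2) => /=; lia.
Qed.

Lemma skel_finite (d i : nat) (r : box d) : finite_set (skel i r).
Proof. by apply: sub_finite_set (box_finite r) => c []. Qed.

Lemma boxpl_finite (d i : nat) (r : box d) : finite_set (@boxpl d i r).
Proof.
apply: (proj1 (@fset_set_card_inj _ _ _ (cell_in_box r) val _ _ _)).
- exact: box_finite.
- by move=> e [].
- by move=> e e' _ _ /val_inj.
Qed.

Lemma mem_box_plaquettes (d i : nat) (r : box d) (e : plaquette d i) :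
  e \in box_plaquettes i r <-> boxpl r e.
Proof.
rewrite /box_plaquettes in_fset_set; last exact: boxpl_finite.
by rewrite inE.
Qed.

Lemma set_box_plaquettes (d i : nat) (r : box d) :
  [set` box_plaquettes i r] = boxpl r.
Proof. by apply/seteqP; split=> e /=; rewrite mem_box_plaquettes. Qed.

Lemma closed_on_box_finite (d i q : nat) (r : box d) (w : set (plaquette d i)) :
  finite_set (@closed_on_box d i q r w).
Proof.
have [+ _] := @supported_card _ 'Z_q _ (skel_finite i r).
apply: sub_finite_set => _ [g _ <-] c; exact: restrict_toN.
Qed.

Lemma closed_onB (d i q : nat) (w : set (plaquette d i)) (f g : cell d ->
  'Z_q) :
  closed_on w f -> closed_on w g -> closed_on w (f - g).
Proof. by move=> fw gw e we; rewrite dcobB fw // gw // subrr. Qed.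

Lemma closed_onD (d i q : nat) (w : set (plaquette d i)) (f g : cell d ->
  'Z_q) :
  closed_on w f -> closed_on w g -> closed_on w (f + g).
Proof. by move=> fw gw e we; rewrite dcobD fw // gw // addr0. Qed.

Lemma closed_on0 (d i q : nat) (w : set (plaquette d i)) :
  closed_on w (0 : cell d -> 'Z_q).
Proof. by move=> e _; rewrite dcob0. Qed.

Lemma closed_on_boxB (d i q : nat) (r : box d) (w : set (plaquette d i)) f g :
  @closed_on_box d i q r w f -> closed_on_box r w g ->
    closed_on_box r w (f - g).
Proof.
move=> [f' fw <-] [g' gw <-]; exists (f' - g'); first exact: closed_onB.
by rewrite restrict_toB.
Qed.

Lemma closed_on_boxD (d i q : nat) (r : box d) (w : set (plaquette d i)) f g :
  @closed_on_box d i q r w f -> closed_on_box r w g ->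
    closed_on_box r w (f + g).
Proof.
move=> [f' fw <-] [g' gw <-]; exists (f' + g'); first exact: closed_onD.
by rewrite restrict_toD.
Qed.

Lemma closed_on_box0 (d i q : nat) (r : box d) (w : set (plaquette d i)) :
  @closed_on_box d i q r w 0.
Proof. by exists 0; [exact: closed_on0|rewrite restrict_to0]. Qed.

Lemma closed_card_gt0 (d i q : nat) (r : box d) (w : set (plaquette d i)) :
  (0 < @closed_card d i q r w)%N.
Proof.
rewrite /closed_card cardfs_gt0; apply/fset0Pn; exists 0.
by rewrite in_fset_set ?inE; [exact: closed_on_box0|exact:
  closed_on_box_finite].
Qed.

Section ImCard.
Variables (d i q : nat) (r : box d) (xi : set (plaquette d i)).
Hypothesis i0 : (0 < i)%N.
Variable P : {fset plaquette d i}.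
Hypothesis PE : (P `<=` box_plaquettes i r)%fset.

Let X := box_complex r P.
Let Y := bc_complex r xi P.
Let w := [set` P] `|` (xi `\` [set` box_plaquettes i r]).

Lemma plaq_dim (e : plaquette d i) : cell_dim (val e) = i.
Proof. by apply/eqP; exact: (valP e). Qed.

Let predi : i.-1.+1 = i. Proof. by rewrite prednK. Qed.

Let X_dim_lt c : (cell_dim c < i)%N -> X c <-> cell_in_box r c.
Proof.
move=> ci; split=> [|rc]; last by left.
by move=> [[]//|[e _ ec]]; move: ci; rewrite -ec plaq_dim ltnn.
Qed.

Let X_in_box c : X c -> cell_in_box r c.
Proof.
move=> [[]//|[e /= eP <-]].
by move/fsubsetP : PE => /(_ _ eP) /mem_box_plaquettes [].
Qed.

Let XY : X `<=` Y. Proof. by move=> c Xc; left; left. Qed.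

Let X_dim_le c : X c -> (cell_dim c <= i)%N.
Proof. by move=> [[_ /ltnW]//|[e _ <-]]; rewrite plaq_dim. Qed.

Let X_front (c : cell d) j : j \in c.2 -> X c -> X (front_face c j).
Proof.
move=> jc Xc; left; split; first by apply: front_face_in_box => //;
  exact: X_in_box.
by have := X_dim_le Xc; rewrite (front_face_dim jc).
Qed.

Let X_back (c : cell d) j : j \in c.2 -> X c -> X (back_face c j).
Proof.
move=> jc Xc; left; split; first by apply: back_face_in_box => //;
  exact: X_in_box.
by have := X_dim_le Xc; rewrite (back_face_dim jc).
Qed.

Let restrict_X_skel (f : cell d -> 'Z_q) :
    (forall c, cell_dim c <> i.-1 -> f c = 0) ->
  restrict_to X f = restrict_to (skel i r) f.
Proof.
move=> f0; apply/funext => c.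
have [ci|ci] := pselect (cell_dim c = i.-1); last first.
  transitivity (0 : 'Z_q); [|apply/esym].
    have [Xc|Xc] := pselect (X c); last by rewrite restrict_toN.
    by rewrite restrict_toT // f0.
  by rewrite restrict_toN // => -[].
have ci' : (cell_dim c < i)%N by rewrite ci prednK.
have [rc|rc] := pselect (cell_in_box r c).
  by rewrite !restrict_toT //; apply/(X_dim_lt ci').
have nX : ~ X c by move/(X_dim_lt ci').
by rewrite !restrict_toN // => -[].
Qed.

Let restrict_coboundaries b : @coboundaries d q Y i.-1 b ->
  coboundaries X i.-1 (restrict_to X b).
Proof.
case: i.-1 => [|k] /=; first by move=> ->; exact: restrict_to0.
move=> [f fY <-]; exists (restrict_to X f).
  move=> c nc; have [Xc|Xc] := pselect (X c); last by rewrite restrict_toN.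
  rewrite restrict_toT // fY // => -[_ ck]; exact: nc.
rewrite /coboundary; apply/funext => c.
have [Xc|Xc] := pselect (X c); last by rewrite !restrict_toN.
rewrite !restrict_toT //; last exact: XY.
by apply: eq_dcob => j jc; rewrite restrict_toT //;
  [exact: X_front|exact: X_back].
Qed.

Let cochains_dim Z k (f : cell d -> 'Z_q) : cochains Z k f ->
  forall c, cell_dim c <> k -> f c = 0.
Proof. by move=> fZ c ck; apply: fZ => -[]. Qed.

(** Up to dimension i-1 the complex consists of all the cells of the box, so its coboundaries in
    degree i-1 do not see [P]. *)
Lemma coboundaries_box : @coboundaries d q X i.-1 =
  if i.-1 is k.+1 then
    [set restrict_to (skel i r) (dcob f) | f in
      [set f | forall c, ~ (cell_in_box r c /\ cell_dim c = k) -> f c = 0]]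
  else [set 0].
Proof.
case ik : i.-1 => [|k] //=.
have H (f : cell d -> 'Z_q) : cochains X k f ->
  coboundary X f = restrict_to (skel i r) (dcob f).
  move=> fX; rewrite -[coboundary X f]/(restrict_to X (dcob f)).
  rewrite restrict_X_skel // => c ci.
  by apply: (dcob_dim0 (cochains_dim fX)); rewrite -ik.
have C (f : cell d -> 'Z_q) : cochains X k f <->
    (forall c, ~ (cell_in_box r c /\ cell_dim c = k) -> f c = 0).
  have ki c : cell_dim c = k -> (cell_dim c < i)%N by move=> ->;
    rewrite -predi ik.
  split=> fX c nc; apply: fX => -[hc ck]; apply: nc; split=> //.
    by apply/X_dim_lt => //; exact: ki.
  by apply/X_dim_lt => //; exact: ki.
apply/seteqP; split=> _ [f fX <-]; exists f => //.
- exact/C.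
- by rewrite H.
- exact/C.
- by rewrite H //; exact/C.
Qed.

(** The i-cells of [Y] are exactly the plaquettes of [w], and [Y] has all the cells of lower
    dimension. Its (i-1)-cocycles are thus the functions closed on [w] and concentrated on
    (i-1)-cells; a class goes to the coset of the restriction, because coboundaries of [Y] restrict
    to coboundaries of [X]. *)
Lemma im_pullbackE : @im_pullback d q X Y i.-1 =
  (fun z => [set (z + b)%R | b in coboundaries X i.-1]) @` closed_on_box r w.
Proof.
have BD b b' : coboundaries X i.-1 b -> coboundaries X i.-1 b' ->
    coboundaries X i.-1 (b + b' : cell d -> 'Z_q).
  rewrite coboundaries_box; case: i.-1 => [|k] /=.
    by move=> -> ->; rewrite addr0.
  move=> [f f0 <-] [g g0 <-]; exists (f + g).
    by move=> c nc; rewrite fctE f0 // g0 // addr0.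
  by rewrite -restrict_toD; congr restrict_to; apply/funext => c; rewrite dcobD.
have E (z : cell d -> 'Z_q) : cocycles Y i.-1 z ->
  pullback X i.-1 (coclass Y i.-1 z) =
    coclass X i.-1 (restrict_to (skel i r) z).
  move=> [zY _]; rewrite -(restrict_X_skel (cochains_dim zY)).
  apply/seteqP; split=> [_ [_ [b Yb <-] [b' Xb' <-]]|_ [b Xb <-]].
    exists (restrict_to X b + b'); first by apply: BD => //;
      exact: restrict_coboundaries.
    by rewrite restrict_toD addrA.
  exists z; last by exists b.
  exists 0; last by rewrite addr0.
  case: i.-1 => [|k] //=; exists 0 => //.
  by rewrite /coboundary -[RHS](restrict_to0 _ Y); congr restrict_to;
    apply/funext => c; exact: dcob0.
apply/seteqP; split=> [_ [_ [z zY <-] <-]|_ [_ [g gw <-] <-]].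
  exists (restrict_to (skel i r) z); last by rewrite E.
  exists z => // e we.
  have Ye : Y (val e).
    by case: we => [Pe|we]; left; [left; right; exists e|right; exists e].
  case: zY => _ /(congr1 (fun f => f (val e))).
  by rewrite /coboundary restrict_toT.
(* A cochain must vanish in other dimensions; cutting [g] down changes neither its coboundary on
   plaquettes nor its restriction to [skel i r]. *)
pose z := restrict_to [set c | cell_dim c = i.-1] g.
have zY : cocycles Y i.-1 z.
  split=> [c nc|].
    have [ci|ci] := pselect (cell_dim c = i.-1);
      last by rewrite /z restrict_toN.
    by case: nc; split=> //; right; rewrite /= ci -[X in (_ < X)%N]predi.
  apply/funext => c; rewrite /coboundary.
  have [Yc|Yc] := pselect (Y c); last by rewrite restrict_toN.
  rewrite restrict_toT // -[LHS]/(dcob z c).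
  have [ci|ci] := pselect (cell_dim c = i); last first.
    apply: (@dcob_dim0 _ _ i.-1); last by rewrite predi.
    by move=> c' c'i; rewrite /z restrict_toN.
  have -> : dcob z c = dcob g c.
    apply: eq_dcob => j jc; rewrite /z restrict_toT //=; rewrite -ci.
      by rewrite (front_face_dim jc).
    by rewrite (back_face_dim jc).
  case: Yc => [[[[_]|[e Pe <-]]|[e xe <-]]|]; rewrite /= ?ci ?ltnn //.
    by apply: gw; left.
  by apply: gw; right.
exists (coclass Y i.-1 z); first by exists z.
rewrite E //; congr (coclass _ _ _); apply/funext => c.
have [sc|sc] := pselect (skel i r c); last by rewrite !restrict_toN.
by rewrite /z !restrict_toT //; case: sc.
Qed.

Lemma im_cardM : (im_card q r xi P * #|` fset_set (@coboundaries d q X i.-1)|)%N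
  = closed_card q r w.
Proof.
rewrite /im_card im_pullbackE; apply: card_cosets.
- exact: closed_on_box_finite.
- rewrite coboundaries_box; case: i.-1 => [|k] /=; first by move=> _ ->;
  exact: closed_on_box0.
  by move=> _ [f _ <-]; exists (dcob f) => // e _; exact: dcob_dcob.
- rewrite coboundaries_box; case: i.-1 => [|k] //=; exists 0 => //.
  rewrite -[RHS](restrict_to0 _ (skel i r)); congr restrict_to.
  by apply/funext => c; exact: dcob0.
- exact: closed_on_boxB.
- rewrite coboundaries_box; case: i.-1 => [|k] /=; first by move=> _ _ -> ->;
  exact: subr0.
  move=> _ _ [f f0 <-] [g g0 <-]; exists (f - g).
    by move=> c nc; rewrite !fctE f0 // g0 // subr0.
  by rewrite -restrict_toB; congr restrict_to; apply/funext => c; rewrite dcobB.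
Qed.

End ImCard.

(** Evaluated at the empty configuration; by [coboundaries_box] every configuration in the box gives
    the same number, which cancels in [prc]. *)
Definition coboundaries_card (d i q : nat) (r : box d) : nat :=
  #|` fset_set (@coboundaries d q (@box_complex d i r fset0) i.-1)|.

Lemma im_card_closed_card (d i q : nat) (r : box d) (xi : set (plaquette d i))
    (P : {fset plaquette d i}) : (0 < i)%N ->
      (P `<=` box_plaquettes i r)%fset ->
  (im_card q r xi P * coboundaries_card i q r)%N =
    closed_card q r ([set` P] `|` (xi `\` boxpl r)).
Proof.
move=> i0 PE; rewrite -set_box_plaquettes -im_cardM //; congr (_ * _)%N.
by rewrite /coboundaries_card !coboundaries_box.
Qed.

Lemma coboundaries_card_gt0 (d i q : nat) (r : box d) : (0 < i)%N ->
  (0 < coboundaries_card i q r)%N.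
Proof.
move=> i0; have := closed_card_gt0 q r ([set` fset0] `|` (set0 `\` @boxpl d i
  r)).
by rewrite -im_card_closed_card // muln_gt0 => /andP[].
Qed.

(** * Index inequalities between groups of closed functions *)

Lemma eq_restrict_dcob (d i q : nat) (r : box d) (f g : cell d -> 'Z_q)
    (e : plaquette d i) : cell_in_box r (val e) ->
    restrict_to (skel i r) f = restrict_to (skel i r) g ->
  dcob f (val e) = dcob g (val e).
Proof.
move=> re fg.
have H c : skel i r c -> f c = g c.
  by move=> sc; rewrite -(restrict_toT f sc) fg restrict_toT.
apply: eq_dcob => j je; apply: H; split.
- exact: front_face_in_box.
- by have := plaq_dim e; rewrite (front_face_dim je) => /(congr1 predn).
- exact: back_face_in_box.
- by have := plaq_dim e; rewrite (back_face_dim je) => /(congr1 predn).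
Qed.

Lemma restrict_sub (d q : nat) (A B : set (cell d)) (f : cell d -> 'Z_q) :
  A `<=` B -> restrict_to A (restrict_to B f) = restrict_to A f.
Proof.
move=> AB; apply/funext => c; have [Ac|Ac] := pselect (A c).
  by rewrite !restrict_toT //; exact: AB.
by rewrite !restrict_toN.
Qed.

Lemma sub_box_skel (d i : nat) (r r' : box d) :
  cell_in_box r `<=` cell_in_box r' -> skel i r `<=` skel i r'.
Proof. by move=> rr' c [rc ci]; split=> //; exact: rr'. Qed.

(** Restriction from [r'] to [r] sends functions closed on [Q] and [eta] to functions closed on [P]
    and [Q] jointly. If a difference restricts to a function closed on [P], it is itself closed on
    [P], since plaquettes of [P] only read cells of [r]. So the index of adding [P] in [r'] is at
    most the index of passing from [P & Q] to [P] in [r]. *)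
Lemma closed_card_free_le (d i q : nat) (r r' : box d) (P Q eta :
  set (plaquette d i)) :
    cell_in_box r `<=` cell_in_box r' -> P `<=` boxpl r ->
  (closed_card q r P * closed_card q r' (Q `|` eta) <=
   closed_card q r (P `&` Q) * closed_card q r' ((P `|` Q) `|` eta))%N.
Proof.
move=> rr' PE; rewrite mulnC [leqRHS]mulnC.
apply: (@card_index_le _ _ _ _ _ _ (restrict_to (skel i r))).
- exact: closed_on_box_finite.
- exact: closed_on_box_finite.
- move=> x y xB [g gP <-]; apply: closed_on_boxD => //;
  exists g => // e [Pe _]; exact: gP.
- move=> _ [g gQ <-]; exists g; last by rewrite restrict_sub //;
  exact: sub_box_skel.
  by move=> e [_ Qe]; apply: gQ; left.
- exact: closed_on_boxB.
- move=> _ _ [g gQ <-] [h hQ <-]; rewrite -!restrict_toB => -[k kP].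
  rewrite !restrict_sub; try exact: sub_box_skel.
  move=> kgh; exists (g - h) => //.
  move=> e [[Pe|Qe]|ee]; last 2 first.
    by rewrite dcobB gQ ?hQ ?subrr //; left.
    by rewrite dcobB gQ ?hQ ?subrr //; right.
  by rewrite -(eq_restrict_dcob _ kgh) ?kP //; case: (PE _ Pe).
- by move=> _ [g gP <-]; exists g => // e [Pe _]; exact: gP.
- exact: closed_on_box_finite.
Qed.

(** Here the map goes from [r] to [r']: a function of the wired box is extended so as to be closed
    outside [r], in particular on [eta], and is then restricted to [r']. If the difference of two
    images is closed on [Q], so is the difference of the extensions at the plaquettes of [r]. *)
Lemma closed_card_wired_le (d i q : nat) (r r' : box d) (P Q eta :
  set (plaquette d i)) :
    cell_in_box r `<=` cell_in_box r' -> eta `<=` ~` boxpl r ->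
  (closed_card q r ((P `&` boxpl r) `|` ~` boxpl r) *
    closed_card q r' (Q `|` eta) <=
   closed_card q r (((P `|` Q) `&` boxpl r) `|` ~` boxpl r) *
     closed_card q r' ((P `&` Q) `|` eta))%N.
Proof.
move=> rr' etaE.
(* The extension is merely chosen, so it need not be additive; this is why [card_index_le] accepts
   arbitrary maps. *)
pose ext (u : cell d -> 'Z_q) := xget 0 [set g |
  closed_on ((P `&` boxpl r) `|` ~` boxpl r) g /\ restrict_to (skel i r) g = u].
have extP u : closed_on_box r ((P `&` boxpl r) `|` ~` boxpl r) u ->
    closed_on ((P `&` boxpl r) `|` ~` boxpl r) (ext u) /\
    restrict_to (skel i r) (ext u) = u.
  move=> [g gP gu]; exact: (xgetPex 0 (P := [set g |
    closed_on ((P `&` boxpl r) `|` ~` boxpl r) g /\ _ = u])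
    (ex_intro _ g (conj gP gu))).
have ext_closed u : closed_on_box r ((P `&` boxpl r) `|` ~` boxpl r) u ->
    closed_on (P `|` eta) (ext u).
  move=> /extP[uP _] e ee; apply: uP.
  have [Ee|Ee] := pselect (boxpl r e); last by right.
  by case: ee => [Pe|/etaE//]; left.
apply: (@card_index_le _ _ _ _ _ _ (fun u => restrict_to (skel i r') (ext u))).
- exact: closed_on_box_finite.
- exact: closed_on_box_finite.
- move=> x y xB [g gP <-]; apply: closed_on_boxD => //;
  exists g => // e [[_ Qe]|ee]; apply: gP.
    by left.
  by right.
- move=> u /ext_closed uP; exists (ext u) => // e [[Pe _]|ee]; apply: uP.
    by left.
  by right.
- exact: closed_on_boxB.
- move=> u v Au Av; rewrite -!restrict_toB => -[k kP] kgh.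
  have [uP eu] := extP _ Au; have [vP ev] := extP _ Av.
  exists (ext u - ext v); last by rewrite restrict_toB eu ev.
  move=> e [[[Pe|Qe] Ee]|Ee].
  + by rewrite dcobB uP ?vP ?subrr //; left.
  + rewrite -(eq_restrict_dcob _ kgh); first by apply: kP; left.
    by apply: rr'; case: Ee.
  + by rewrite dcobB uP ?vP ?subrr //; right.
- by move=> _ [g gP <-]; exists g => // e [[_ Qe]|ee]; apply: gP; [left|right].
- exact: closed_on_box_finite.
Qed.

Lemma closed_card_antimono (d i q : nat) (r : box d) (w w' :
  set (plaquette d i)) :
  w `<=` w' -> (closed_card q r w' <= closed_card q r w)%N.
Proof.
move=> ww'; apply: (proj2 (@fset_set_card_inj _ _ _ _ id _ _ _)) => //.
- exact: closed_on_box_finite.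
- by move=> _ [g gw <-]; exists g => // e we; apply: gw; exact: ww'.
Qed.

Definition boundary_cells (d i : nat) (r : box d) : set (cell d) :=
  [set c | skel i r c /\
    exists j, j \notin c.2 /\ (c.1 j = box_lo r j \/ c.1 j = box_hi r j)].

(** A cell of the box lying in no bounding hyperplane has all its fixed coordinates strictly inside;
    a plaquette having it as a face is then contained in the box and meets its interior. *)
Lemma face_boundary_cells (d i : nat) (r : box d) (e : plaquette d i) (j :
  'I_d) c :
    ~ boxpl r e -> j \in (val e).2 ->
    c = front_face (val e) j \/ c = back_face (val e) j ->
    skel i r c -> boundary_cells i r c.
Proof.
move=> nE je ce sc; split=> //; apply: contrapT => nb; apply: nE.
case: sc => rc _.
have {nb} int_c l : l \notin c.2 -> box_lo r l < c.1 l < box_hi r l.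
  move=> lc; have := rc l; rewrite /cell_lo /cell_hi (negbTE lc) addr0 =>
    -[h1 h2].
  rewrite !lt_neqAle h1 h2 !andbT; apply/andP; split.
    by apply/eqP => e'; apply: nb; exists l; split=> //; left.
  by apply/eqP => e'; apply: nb; exists l; split=> //; right.
have key l : [/\ box_lo r l <= (val e).1 l,
    (val e).1 l + (l \in (val e).2)%:R <= box_hi r l,
    (val e).1 l < box_hi r l & box_lo r l < (val e).1 l + (l \in (val e).2)%:R].
  have := int_c l; have := rc l; rewrite /cell_lo /cell_hi.
  case: ce => ->; rewrite /= ?ffunE !inE.
    case: eqP => [->|_] /=.
      by rewrite je => _ /(_ isT); split; lia.
    by case: (l \in _) => /=; [move=> [? ?] _; split; lia|move=> _ /(_ isT) ?;
      split; lia].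
  case: eqP => [->|_] /=.
    by rewrite je => _ /(_ isT); split; lia.
  by case: (l \in _) => /=; [move=> [? ?] _; split; lia|move=> _ /(_ isT) ?;
    split; lia].
by split=> l; have [? ? ? ?] := key l.
Qed.

(** Two functions closed on [P] with the same values on the boundary cells differ by an element of
    the wired group, so the index of that group is at most the number of boundary values. *)
Lemma closed_card_boundary_le (d i q : nat) (r : box d) (P :
  set (plaquette d i)) :
    P `<=` boxpl r ->
  (closed_card q r P <= closed_card q r (P `|` ~` boxpl r) *
    #|'Z_q| ^ #|` fset_set (boundary_cells i r)|)%N.
Proof.
move=> PE.
have finb : finite_set (boundary_cells i r) by apply: sub_finite_set
  (skel_finite i r) => c [].
have [finB cardB] := @supported_card _ 'Z_q _ finb.
apply: (@leq_trans (closed_card q r (P `|` ~` boxpl r) *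
   #|` fset_set (@supported _ 'Z_q (boundary_cells i r))|)%N);
     last by rewrite leq_mul2l cardB orbT.
rewrite -[X in (X <= _)%N]muln1.
have -> : 1%N = #|` fset_set [set (0 : cell d ->
  'Z_q)]| by rewrite fset_set1 cardfs1.
apply: (@card_index_le _ _ _ _ _ _ (restrict_to (boundary_cells i r))).
- exact: closed_on_box_finite.
- exact: finB.
- by move=> x y Bx ->; rewrite addr0.
- by move=> u _ c nc; rewrite restrict_toN.
- by move=> _ _ -> ->; rewrite subr0.
- move=> _ _ [g gP <-] [h hP <-]; rewrite -!restrict_toB.
  set k := restrict_to _ (g - h) => k0.
  have kk : restrict_to (skel i r) k = k by rewrite restrict_sub.
  (* [k] is zero off the (i-1)-cells of the box. A plaquette not in [boxpl r] meets those cells only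
     in boundary cells, where [k] vanishes as well. *)
  exists k => // e [Pe|Ee].
    rewrite (@eq_restrict_dcob _ i _ r _ (g - h)) //.
      by rewrite dcobB gP // hP // subrr.
    by case: (PE _ Pe).
  rewrite -(dcob0 q (val e)).
  have kc c : (skel i r c -> boundary_cells i r c) -> k c = 0.
    move=> sb; have [sc|sc] := pselect (skel i r c);
      last by rewrite /k restrict_toN.
    by rewrite -(restrict_toT k (sb sc)) k0.
  apply: eq_dcob => j je; apply: kc.
    by apply: (face_boundary_cells Ee je); left.
  by apply: (face_boundary_cells Ee je); right.
- by move=> _ ->.
- exact: closed_on_box_finite.
Qed.

(** * Translations *)

Definition shift_cell (d : nat) (x : 'I_d -> int) (c : cell d) : cell d :=
  ([ffun j => c.1 j + x j], c.2).

Lemma shift_cell_dim (d i : nat) (x : 'I_d -> int) (e : plaquette d i) :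
  cell_dim (shift_cell x (val e)) == i.
Proof. exact: (valP e). Qed.

Definition shift_plaq (d i : nat) (x : 'I_d -> int) (e : plaquette d i) :
  plaquette d i := exist _ (shift_cell x (val e)) (shift_cell_dim x e).

Lemma shift_box_ltP (d : nat) (x : 'I_d -> int) (r : box d) (j : 'I_d) :
  box_lo r j + x j < box_hi r j + x j.
Proof. by rewrite ltrD2r; exact: box_ltP. Qed.

Definition shift_box (d : nat) (x : 'I_d -> int) (r : box d) : box d :=
  Box (shift_box_ltP x r).

Lemma shift_cellK (d : nat) (x : 'I_d -> int) :
  cancel (shift_cell x) (shift_cell (fun j => - x j)).
Proof.
by move=> [a S]; congr pair; apply/ffunP => j; rewrite !ffunE /= addrK.
Qed.

Lemma shift_cellNK (d : nat) (x : 'I_d -> int) :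
  cancel (shift_cell (fun j => - x j)) (shift_cell x).
Proof.
by move=> [a S]; congr pair; apply/ffunP => j; rewrite !ffunE /= subrK.
Qed.

Lemma shift_plaqK (d i : nat) (x : 'I_d -> int) :
  cancel (@shift_plaq d i x) (shift_plaq (fun j => - x j)).
Proof. by move=> e; apply: val_inj; exact: shift_cellK. Qed.

Lemma shift_plaqNK (d i : nat) (x : 'I_d -> int) :
  cancel (@shift_plaq d i (fun j => - x j)) (shift_plaq x).
Proof. by move=> e; apply: val_inj; exact: shift_cellNK. Qed.

Lemma shift_in_box (d : nat) (x : 'I_d -> int) (r : box d) c :
  cell_in_box (shift_box x r) (shift_cell x c) <-> cell_in_box r c.
Proof.
split=> rc j; have := rc j; rewrite /cell_lo /cell_hi /= ffunE; lia.
Qed.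

Lemma shift_boxpl (d i : nat) (x : 'I_d -> int) (r : box d) (e :
  plaquette d i) :
  boxpl (shift_box x r) (shift_plaq x e) <-> boxpl r e.
Proof.
split=> -[/shift_in_box re me]; split=> // j; have := me j;
  rewrite /cell_lo /cell_hi /= ffunE; lia.
Qed.

Lemma dcob_shift (d q : nat) (x : 'I_d -> int) (f : cell d -> 'Z_q) (c :
  cell d) :
  dcob (f \o shift_cell x) c = dcob f (shift_cell x c).
Proof.
rewrite /dcob; apply: eq_bigr => j jc; congr (_ * (f _ - f _)).
by congr pair; apply/ffunP => l; rewrite !ffunE addrAC.
Qed.

Lemma closed_card_shift (d i q : nat) (x : 'I_d -> int) (r : box d)
    (w : set (plaquette d i)) :
  closed_card q (shift_box x r) w = closed_card q r (shift_plaq x @^-1` w).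
Proof.
have shift_inj (f g : cell d -> 'Z_q) :
    f \o shift_cell x = g \o shift_cell x -> f = g.
  move=> fg; apply/funext => c; rewrite -(shift_cellNK x c).
  exact: (congr1 (fun h => h (shift_cell (fun j => - x j) c)) fg).
have sk c : skel i (shift_box x r) (shift_cell x c) <-> skel i r c.
  by split=> -[/shift_in_box rc ci]; split.
have res (g : cell d -> 'Z_q) : restrict_to (skel i (shift_box x r)) g \o
  shift_cell x =
    restrict_to (skel i r) (g \o shift_cell x).
  apply/funext => c /=; have [sc|sc] := pselect (skel i r c).
    by rewrite !restrict_toT //; apply/sk.
  by rewrite !restrict_toN //; move/sk.
rewrite /closed_card.
have -> : closed_on_box r (shift_plaq x @^-1` w) =
    (fun f => f \o shift_cell x) @` @closed_on_box d i q (shift_box x r) w.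
  apply/seteqP; split=> [_ [g gw <-]|_ [_ [g gw <-] <-]].
    exists (restrict_to (skel i (shift_box x r)) (g \o shift_cell (fun j =>
      - x j))).
      exists (g \o shift_cell (fun j => - x j)) => // e we.
      rewrite dcob_shift; apply: (gw (shift_plaq (fun j => - x j) e)).
      by rewrite /= shift_plaqNK.
    by rewrite res; congr restrict_to; apply/funext => c /=;
      rewrite shift_cellK.
  by rewrite res; exists (g \o shift_cell x) => // e we; rewrite dcob_shift;
    exact: gw we.
apply/esym/fset_set_card_image; first exact: closed_on_box_finite.
by move=> f g _ _; exact: shift_inj.
Qed.

(** * Expectations of functions of a configuration in a box *)

Definition rc_weight (R : realType) (d i q : nat) (x : R) (r : box d)
    (xi : set (plaquette d i)) (P : {fset plaquette d i}) : R :=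
  x ^+ #|` P| * (closed_card q r ([set` P] `|` (xi `\` boxpl r)))%:R.

Definition rc_sum (R : realType) (d i q : nat) (x : R) (r : box d)
    (xi : set (plaquette d i)) : R :=
  \sum_(P <- fpowerset (box_plaquettes i r)) rc_weight q x r xi P.

Definition mean (R : realType) (d i q : nat) (x : R) (r : box d)
    (xi : set (plaquette d i)) (phi : set (plaquette d i) -> R) : R :=
  (\sum_(P <- fpowerset (box_plaquettes i r)) rc_weight q x r xi P *
    phi [set` P]) /
  rc_sum q x r xi.

Lemma rc_weight_gt0 (R : realType) (d i q : nat) (x : R) (r : box d)
    (xi : set (plaquette d i)) P : 0 < x -> 0 < rc_weight q x r xi P.
Proof. by move=> x0; rewrite mulr_gt0 ?exprn_gt0 // ltr0n closed_card_gt0. Qed.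

Lemma rc_sum_gt0 (R : realType) (d i q : nat) (x : R) (r : box d)
    (xi : set (plaquette d i)) : 0 < x -> 0 < rc_sum q x r xi.
Proof.
move=> x0; rewrite /rc_sum (big_fsetD1 fset0) /=;
  last by rewrite fpowersetE fsub0set.
by rewrite ltr_wpDr ?rc_weight_gt0 //; apply: sumr_ge0 => P _;
  rewrite ltW // rc_weight_gt0.
Qed.

Lemma prc_weightE (R : realType) (d i q : nat) (p : R) (r : box d)
    (xi : set (plaquette d i)) P : (0 < i)%N -> 0 < p < 1 ->
    (P `<=` box_plaquettes i r)%fset ->
  prc_weight q p r xi P * (coboundaries_card i q r)%:R =
  (1 - p) ^+ #|` box_plaquettes i r| * rc_weight q (p / (1 - p)) r xi P.
Proof.
move=> i0 /andP[p0 p1] PE.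
have p1' : 1 - p != 0 by rewrite subr_eq0 gt_eqF.
rewrite /prc_weight /rc_weight -mulrA -natrM im_card_closed_card // !mulrA;
  congr (_ * _).
rewrite expr_div_n mulrCA; congr (_ * _).
by rewrite -exprB ?fsubset_leq_card ?unitfE.
Qed.

Lemma prc_partitionE (R : realType) (d i q : nat) (p : R) (r : box d)
    (xi : set (plaquette d i)) : (0 < i)%N -> 0 < p < 1 ->
  prc_partition q p r xi * (coboundaries_card i q r)%:R =
  (1 - p) ^+ #|` box_plaquettes i r| * rc_sum q (p / (1 - p)) r xi.
Proof.
move=> i0 p01; rewrite /prc_partition /rc_sum mulr_suml mulr_sumr big_seq
  [RHS]big_seq.
by apply: eq_bigr => P; rewrite fpowersetE => PE; exact: prc_weightE.
Qed.

Lemma odds_gt0 (R : realType) (p : R) : 0 < p < 1 -> 0 < p / (1 - p).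
Proof. by move=> /andP[p0 p1]; rewrite divr_gt0 ?subr_gt0. Qed.

Lemma prc_probE (R : realType) (d i q : nat) (p : R) (r : box d)
    (xi : set (plaquette d i)) A : (0 < i)%N -> 0 < p < 1 ->
  prc_prob q p r xi A = mean q (p / (1 - p)) r xi (fun w => (`[< A w >])%:R).
Proof.
move=> i0 p01; rewrite /prc_prob /mean big_mkcond /= mulr_suml big_seq
  [RHS]big_seq.
have B0 : (coboundaries_card i q r)%:R != 0 :> R by rewrite pnatr_eq0 -lt0n
  coboundaries_card_gt0.
have Z0 := rc_sum_gt0 q r xi (odds_gt0 p01).
have p1' : (1 - p) ^+ #|` box_plaquettes i r| != 0 :> R.
  by case/andP: p01 => p0 p1; rewrite expf_neq0 // subr_eq0 gt_eqF.
apply: eq_bigr => P; rewrite fpowersetE => PE.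
case: asboolP => _; last by rewrite mulr0 mul0r.
rewrite mulr1 /prc -[prc_weight _ _ _ _ _](mulfK B0) prc_weightE //.
rewrite -[prc_partition _ _ _ _](mulfK B0) prc_partitionE //.
have frac (F : fieldType) (c w b z : F) : c != 0 -> b != 0 -> z != 0 ->
    c * w / b / (c * z / b) = w / z.
  by move=> c0 b0 z0; field; rewrite z0 b0 c0.
by apply: frac; rewrite // gt_eqF.
Qed.

(** The factor (1-p)^-n of Y absorbs the one produced by the change to odds, and the coboundary term
    does not depend on [p]: second differences of the pressure are those of ln [rc_sum] divided by
    n. *)
Lemma box_pressureE (R : realType) (d i q : nat) (p : R) (r : box d)
    (xi : set (plaquette d i)) : (0 < i)%N -> 0 < p < 1 ->
  box_pressure q p r xi = (#|` box_plaquettes i r|%:R)^-1 *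
    (ln (rc_sum q (p / (1 - p)) r xi) - ln (coboundaries_card i q r)%:R).
Proof.
move=> i0 p01; rewrite /box_pressure; congr (_ * _).
have B0 : 0 < (coboundaries_card i q r)%:R :> R by rewrite ltr0n
  coboundaries_card_gt0.
have Z0 := rc_sum_gt0 q r xi (odds_gt0 p01).
have p1' : (1 - p) ^+ #|` box_plaquettes i r| != 0 :> R.
  by case/andP: p01 => p0 p1; rewrite expf_neq0 // subr_eq0 gt_eqF.
rewrite -ln_div ?posrE //; congr ln.
rewrite -[prc_partition _ _ _ _](mulfK (lt0r_neq0 B0)) prc_partitionE //.
by rewrite mulrA mulKf.
Qed.

Definition corner (d : nat) (v : 'I_d -> int) : cell d :=
  ([ffun j => v j], finset.set0).

Lemma corner_in_box (d : nat) (r : box d) (v : 'I_d -> int) :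
  cell_in_box r (corner v) <-> forall j, box_lo r j <= v j <= box_hi r j.
Proof.
split=> h j; have := h j; rewrite /cell_lo /cell_hi /= ffunE !inE addr0; lia.
Qed.

(** Tested on two opposite vertices of the smaller box. *)
Lemma sub_box_lohi (d : nat) (r s : box d) : cell_in_box s `<=` cell_in_box r ->
  forall j, box_lo r j <= box_lo s j /\ box_hi s j <= box_hi r j.
Proof.
move=> sr j.
have /sr/corner_in_box/(_ j) lo : cell_in_box s (corner (box_lo s)).
  by apply/corner_in_box => l; have := box_ltP s l; lia.
have /sr/corner_in_box/(_ j) hi : cell_in_box s (corner (box_hi s)).
  by apply/corner_in_box => l; have := box_ltP s l; lia.
by lia.
Qed.

Lemma boxpl_sub (d i : nat) (r r' : box d) :
  cell_in_box r `<=` cell_in_box r' ->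
  @boxpl d i r `<=` boxpl r'.
Proof.
move=> rr' e [re me]; split; first exact: rr'.
by move=> j; have := sub_box_lohi rr' j; have := me j; lia.
Qed.

Lemma ratio_le (R : realFieldType) (a b c e : R) : 0 < b -> 0 < e ->
  a * e <= b * c -> a / b <= c / e.
Proof. by move=> b0 e0 h; rewrite ler_pdivrMr // mulrAC ler_pdivlMr // [c *
  b]mulrC. Qed.

(** * Stochastic domination between boxes *)

Section Ex.
Variables (R : realType) (d i q : nat) (x : R).
Hypothesis x0 : 0 < x.
Implicit Types (r : box d) (xi : set (plaquette d i)) (phi :
  set (plaquette d i) -> R).

Lemma meanD r xi phi psi : mean q x r xi (fun w => phi w + psi w) =
  mean q x r xi phi + mean q x r xi psi.
Proof. by rewrite /mean -mulrDl -big_split; congr (_ / _);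
  apply: eq_bigr => P _ /=; rewrite mulrDr. Qed.

Lemma meanZ r xi phi a : mean q x r xi (fun w =>
  a * phi w) = a * mean q x r xi phi.
Proof. by rewrite /mean mulrA mulr_sumr; congr (_ / _); apply: eq_bigr => P _;
  rewrite mulrCA. Qed.

Lemma mean_cst r xi a : mean q x r xi (fun=> a) = a.
Proof. by rewrite /mean -mulr_suml mulrAC divff ?mul1r // gt_eqF // rc_sum_gt0.
  Qed.

Lemma meanB r xi phi psi : mean q x r xi (fun w => phi w - psi w) =
  mean q x r xi phi - mean q x r xi psi.
Proof.
rewrite meanD; congr (_ + _); rewrite -mulN1r -meanZ; congr mean.
by apply/funext => w; rewrite mulN1r.
Qed.

Lemma mean_sum (I : Type) (s : seq I) r xi (phi : I -> set (plaquette d i) ->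
  R) :
  mean q x r xi (fun w => \sum_(k <- s) phi k w) =
    \sum_(k <- s) mean q x r xi (phi k).
Proof.
elim: s => [|k s IH].
  by rewrite big_nil -[RHS](mean_cst r xi 0); congr mean; apply/funext => w;
    rewrite big_nil.
rewrite big_cons -IH -meanD; congr mean; apply/funext => w; by rewrite big_cons.
Qed.

Lemma mean_ge0 r xi phi : (forall w, 0 <= phi w) -> 0 <= mean q x r xi phi.
Proof.
move=> phi0; apply: divr_ge0; last by rewrite ltW // rc_sum_gt0.
apply: sumr_ge0 => P _.
by rewrite mulr_ge0 // ltW // rc_weight_gt0.
Qed.

Let fsub_set (P Q : {fset plaquette d i}) : (P `<=` Q)%fset <->
  [set` P] `<=` [set` Q].
Proof. by split=> [/fsubsetP|PQ]; [|apply/fsubsetP]. Qed.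

Let set_fsetU (P Q : {fset plaquette d i}) :
  [set` (P `|` Q)%fset] = [set` P] `|` [set` Q].
Proof.
apply/seteqP; split=> e /=; first by rewrite inE => /orP.
by move=> h; rewrite inE; apply/orP.
Qed.

Let set_fsetI (P Q : {fset plaquette d i}) :
  [set` (P `&` Q)%fset] = [set` P] `&` [set` Q].
Proof.
apply/seteqP; split=> e /=; first by rewrite inE => /andP.
by move=> h; rewrite inE; apply/andP.
Qed.

Let expU (P Q : {fset plaquette d i}) :
  x ^+ #|` P| * x ^+ #|` Q| = x ^+ #|` (P `&` Q)%fset| *
    x ^+ #|` (P `|` Q)%fset| :> R.
Proof. by rewrite -!exprD -(cardfsUI P Q) addnC. Qed.

Lemma mean_free_le0 r r' xi phi : cell_in_box r `<=` cell_in_box r' ->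
    (forall w w', w `<=` w' -> phi w <= phi w') -> (forall w, 0 <= phi w) ->
  mean q x r set0 phi <= mean q x r' xi phi.
Proof.
move=> rr' phiM phi0.
set E := box_plaquettes i r; set E' := box_plaquettes i r'.
have EE' : (E `<=` E')%fset.
  apply/fsub_set; rewrite !set_box_plaquettes; exact: boxpl_sub.
(* The free measure of [r] carried to the larger box with all the other plaquettes closed, so that
   both measures live on the same power set. *)
pose m1 (P : {fset plaquette d i}) := if (P `<=` E)%fset then rc_weight q x r
  set0 P else 0.
have ext (F : {fset plaquette d i} -> R) :
    \sum_(P <- fpowerset E) rc_weight q x r set0 P * F P =
      \sum_(P <- fpowerset E') m1 P * F P.
  rewrite -(@big_fset_incl _ _ _ _ (fpowerset E) (fpowerset E')) ?fpowersetS
    //; last first.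
    by move=> P _; rewrite /m1 fpowersetE => /negbTE ->; rewrite mul0r.
  by rewrite big_seq [RHS]big_seq; apply: eq_bigr => P;
    rewrite /m1 fpowersetE => ->.
have ext1 : rc_sum q x r (@set0 (plaquette d i)) =
  \sum_(P <- fpowerset E') m1 P.
  transitivity (\sum_(P <- fpowerset E) rc_weight q x r (@set0 (plaquette d i))
    P * 1).
    by rewrite /rc_sum; apply: eq_bigr => P _; rewrite mulr1.
  by rewrite ext; apply: eq_bigr => P _; rewrite mulr1.
rewrite /mean -/E -/E' ext; apply: ratio_le; rewrite ?rc_sum_gt0 // ext1.
apply: holley.
- by move=> P; rewrite /m1; case: ifP => // _; rewrite ltW // rc_weight_gt0.
- by move=> P; rewrite ltW // rc_weight_gt0.
- by move=> P; exact: phi0.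
- by move=> P Q /fsub_set; exact: phiM.
- move=> P Q PE' QE'; rewrite /m1; case: ifP => [PE|_]; last first.
    rewrite mul0r mulr_ge0 //; last by rewrite ltW // rc_weight_gt0.
    by case: ifP => // _; rewrite ltW // rc_weight_gt0.
  rewrite (fsubset_trans (fsubsetIl _ _) PE) /rc_weight mulrACA [leRHS]mulrACA
    expU.
  rewrite ler_pM2l ?mulr_gt0 ?exprn_gt0 // -!natrM ler_nat !set0D !setU0.
  rewrite set_fsetI set_fsetU; apply: closed_card_free_le => //.
  by rewrite -set_box_plaquettes; apply/fsub_set.
Qed.

Lemma mean_le_wired0 r r' xi phi : cell_in_box r `<=` cell_in_box r' ->
    (forall w w', w `<=` w' -> phi w <= phi w') -> (forall w, 0 <= phi w) ->
    (forall w, phi (w `&` boxpl r) = phi w) ->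
  mean q x r' xi phi <= mean q x r setT phi.
Proof.
move=> rr' phiM phi0 phiE.
set E := box_plaquettes i r; set E' := box_plaquettes i r'.
have EE' : (E `<=` E')%fset.
  apply/fsub_set; rewrite !set_box_plaquettes; exact: boxpl_sub.
have setE : [set` E] = boxpl r by rewrite set_box_plaquettes.
pose O := (E' `\` E)%fset.
(* The wired measure of [r] carried to the larger box with all the plaquettes of [O] open. This
   multiplies every weight by x^|O|, and it preserves the integral of [phi] because [phi] only reads
   plaquettes of [r]. *)
pose m2 (P : {fset plaquette d i}) := if (O `<=` P)%fset then
   x ^+ #|` P| * (closed_card q r (([set` P] `&` boxpl r) `|` ~` boxpl r))%:R
     else 0.
have EO P : (P `<=` E)%fset -> [disjoint P & O]%fset.
  move=> /fsubsetP PE; apply/fdisjointP => e /PE eE; by rewrite inE eE.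
have UO P : (P `<=` E)%fset -> ((P `|` O) `&` E)%fset = P.
  move=> /fsubsetP PE; apply/fsetP => e; rewrite !inE; have := PE e.
  by case: (e \in P); case: (e \in E); rewrite ?andbF // => /(_ isT).
have ext (F : {fset plaquette d i} -> R) : (forall P, (P `<=` E)%fset ->
  F (P `|` O)%fset = F P) ->
    x ^+ #|` O| * (\sum_(P <- fpowerset E) rc_weight q x r setT P * F P) =
    \sum_(P <- fpowerset E') m2 P * F P.
  move=> FE.
  rewrite -(@big_fset_incl _ _ _ _ ((fun P =>
    P `|` O)%fset @` fpowerset E)%fset (fpowerset E')); first last.
  - move=> P; rewrite fpowersetE => PE' nP; rewrite /m2; case: ifP => [OP|];
    last by rewrite mul0r.
    case/negP: nP; apply/imfsetP; exists (P `&` E)%fset => /=.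
      by rewrite fpowersetE fsubsetIr.
    apply/fsetP => e; rewrite !inE.
    have := fsubsetP OP e; have := fsubsetP PE' e; rewrite !inE.
    by case: (e \in P); case: (e \in E); case: (e \in E') => //= H1 H2;
      [have := H1 isT|have := H2 isT].
  - apply/fsubsetP => _ /imfsetP[P /= PE ->]; rewrite fpowersetE in PE;
    rewrite fpowersetE.
    by rewrite fsubUset (fsubset_trans PE EE') fsubsetDl.
  rewrite [RHS]big_imfset /=; last first.
    move=> P Q; rewrite /= !fpowersetE => /UO PO /UO QO e.
    by rewrite -PO -QO e.
  rewrite mulr_sumr big_seq [RHS]big_seq; apply: eq_bigr => P;
    rewrite fpowersetE => PE.
  rewrite FE // mulrA; congr (_ * _).
  rewrite /m2 fsubsetUr /rc_weight mulrA cardfsU (eqP (EO _ PE)) cardfs0 subn0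
    -exprD addnC.
  congr (_ * _%:R); congr (closed_card q r _); rewrite setTD set_fsetU setIUl.
  have -> : [set` O] `&` boxpl r = set0.
    by rewrite -setE; apply/seteqP; split=> e //= -[];
      rewrite inE => /andP[/negP].
  rewrite setU0; congr (_ `|` _); rewrite -setE; apply/esym/setIidPl;
    exact/fsub_set.
have phiO P : (P `<=` E)%fset -> phi [set` (P `|` O)%fset] = phi [set` P].
  move=> PE; rewrite -phiE -[RHS]phiE -setE -!set_fsetI UO //.
  by have /fsetIidPl -> := PE.
have ext1 : x ^+ #|` O| * rc_sum q x r (@setT (plaquette d i)) =
  \sum_(P <- fpowerset E') m2 P.
  transitivity (x ^+ #|` O| * \sum_(P <- fpowerset E) rc_weight q x r (@setT
    (plaquette d i)) P * 1).
    by rewrite /rc_sum; congr (_ * _); apply: eq_bigr => P _; rewrite mulr1.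
  by rewrite ext //; apply: eq_bigr => P _; rewrite mulr1.
have xO : 0 < x ^+ #|` O| by rewrite exprn_gt0.
have -> : mean q x r setT phi = (x ^+ #|` O| *
  (\sum_(P <- fpowerset E) rc_weight q x r setT P * phi [set` P])) /
    (x ^+ #|` O| * rc_sum q x r (@setT (plaquette d i))).
  by rewrite invfM mulrACA divff ?mul1r // gt_eqF.
apply: ratio_le; rewrite ?mulr_gt0 ?rc_sum_gt0 //.
rewrite (ext (fun P => phi [set` P])) // ext1.
apply: holley.
- by move=> P; rewrite ltW // rc_weight_gt0.
- by move=> P; rewrite /m2; case: ifP => // _;
  rewrite mulr_ge0 ?ler0n // exprn_ge0 // ltW.
- by move=> P; exact: phi0.
- by move=> P Q /fsub_set; exact: phiM.
- move=> P Q PE' QE'; rewrite /m2; case: ifP => [OQ|_]; last first.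
    rewrite mulr0 mulr_ge0 //; first by rewrite ltW // rc_weight_gt0.
    by case: ifP => // _; rewrite mulr_ge0 ?ler0n // exprn_ge0 // ltW.
  rewrite (fsubset_trans OQ (fsubsetUr _ _)) /rc_weight mulrACA [leRHS]mulrACA
    expU.
  rewrite ler_pM2l ?mulr_gt0 ?exprn_gt0 // -!natrM ler_nat.
  rewrite set_fsetI set_fsetU [X in (X <= _)%N]mulnC [X in (_ <= X)%N]mulnC.
  rewrite [[set` P] `&` [set` Q]]setIC [[set` P] `|` [set` Q]]setUC;
    apply: closed_card_wired_le => //.
  by move=> e [_ nE] /(boxpl_sub rr').
Qed.

Lemma mean_free_le r r' xi phi : cell_in_box r `<=` cell_in_box r' ->
    (forall w w', w `<=` w' -> phi w <= phi w') ->
  mean q x r set0 phi <= mean q x r' xi phi.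
Proof.
(* Holley's inequality needs a nonnegative function; [phi set0] is the least value of the increasing
   [phi]. *)
move=> rr' phiM; have H : mean q x r set0 (fun w => phi w - phi set0) <=
    mean q x r' xi (fun w => phi w - phi set0).
  apply: mean_free_le0 => // [w w' ww'|w]; first by rewrite lerD2r phiM.
  by rewrite subr_ge0 phiM.
by move: H; rewrite !meanB !mean_cst lerD2r.
Qed.

Lemma mean_le_wired r r' xi phi : cell_in_box r `<=` cell_in_box r' ->
    (forall w w', w `<=` w' -> phi w <= phi w') ->
    (forall w, phi (w `&` boxpl r) = phi w) ->
  mean q x r' xi phi <= mean q x r setT phi.
Proof.
move=> rr' phiM phiE; have H : mean q x r' xi (fun w => phi w - phi set0) <=
    mean q x r setT (fun w => phi w - phi set0).
  apply: mean_le_wired0 => // [w w' ww'|w|w]; first by rewrite lerD2r phiM.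
    by rewrite subr_ge0 phiM.
  by rewrite phiE.
by move: H; rewrite !meanB !mean_cst lerD2r.
Qed.

End Ex.

(** * Counting cells of large boxes *)

Lemma exhausting_sub (d : nat) (r : nat -> box d) : exhausting r ->
  forall k l, (k <= l)%N -> cell_in_box (r k) `<=` cell_in_box (r l).
Proof.
move=> [inc _] k l /subnK <-; elim: (l - k)%N => // n IH c /IH; exact: inc.
Qed.

Lemma exhausting_box (d : nat) (r : nat -> box d) (s : box d) : exhausting r ->
  \forall k \near \oo, cell_in_box s `<=` cell_in_box (r k).
Proof.
move=> exr.
have ev (c : cell d) : \forall k \near \oo, cell_in_box (r k) c.
  have : (\bigcup_k cell_in_box (r k)) c by rewrite (proj2 exr).
  by move=> [k _ kc]; exists k => // l /= kl; exact: exhausting_sub kc.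
near=> k.
have lo : cell_in_box (r k) (corner (box_lo s)) by near: k; exact: ev.
have hi : cell_in_box (r k) (corner (box_hi s)) by near: k; exact: ev.
move/corner_in_box: lo => lo; move/corner_in_box: hi => hi.
by move=> c sc j; have := lo j; have := hi j; have := sc j; lia.
Unshelve. all: by end_near. Qed.

Lemma cube_ltP (d N : nat) (j : 'I_d) : - N.+1%:Z < N.+1%:Z. Proof. by lia. Qed.

Definition cube (d N : nat) : box d := Box (@cube_ltP d N).

(** Weierstrass' product inequality. *)
Lemma prod_ge_subsum (R : realFieldType) (I : Type) (s : seq I) (u : I -> R) :
    (forall k, 0 <= u k <= 1) ->
  1 - \sum_(k <- s) (1 - u k) <= \prod_(k <- s) u k.
Proof.
move=> u01; have p1 t : 0 <= \prod_(k <- t) u k <= 1.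
  elim: t => [|k t /andP[IH0 IH1]]; first by rewrite big_nil ler01 lexx.
  have /andP[uk0 uk1] := u01 k.
  by rewrite big_cons mulr_ge0 //= mulr_ile1.
elim: s => [|k s IH]; first by rewrite !big_nil subr0.
rewrite !big_cons; have /andP[uk0 uk1] := u01 k; have /andP[? ?] := p1 s; nra.
Qed.

Lemma card_set_ord (d : nat) : #|{set 'I_d}| = (2 ^ d)%N.
Proof. by rewrite -cardsT -powersetT card_powerset cardsT card_ord. Qed.

Section Counting.
Variables (d i : nat) (r : box d).

(** Cells are counted by base points, each carrying one cell per direction set and hence 2^d cells:
    all lattice points [A] bound the plaquettes from above, the interior points [I] bound those of
    one direction set from below, and [A] minus [I] bounds the boundary cells. *)
Let A := grid (box_lo r) (box_hi r).
Let I := grid (fun j => box_lo r j + 1) (fun j => box_hi r j - 1).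

Let finA : finite_set A.
Proof. by apply: (proj1 (grid_card _)) => j; have := box_ltP r j; lia. Qed.

Let IA : I `<=` A. Proof. by move=> a aI j; have := aI j; lia. Qed.

Let finI : finite_set I. Proof. exact: sub_finite_set finA. Qed.

Lemma card_boxpl_le : (#|` box_plaquettes i r| <= 2 ^ d * #|` fset_set A|)%N.
Proof.
have := @fset_set_card_inj _ _ (@boxpl d i r) (A `*` [set: {set 'I_d}])
  (val : plaquette d i -> {ffun 'I_d -> int} * {set 'I_d}).
move=> /(_ (finite_setX finA finite_finset));
  rewrite (fset_set_cardX finA finite_finset).
rewrite fset_set_setT_card card_set_ord mulnC; move=> H; apply: (proj2 (H _ _)).
  move=> e [re _]; split=> // j; have := re j; rewrite /cell_lo /cell_hi.
  by case: (j \in _) => /=; lia.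
by move=> e e' _ _ /val_inj.
Qed.

Lemma card_boundary_cells_le : (#|` fset_set (boundary_cells i r)| <=
  2 ^ d * (#|` fset_set A| - #|` fset_set I|))%N.
Proof.
have := @fset_set_card_inj _ _ (boundary_cells i r) ((A `\` I) `*` [set: {set
  'I_d}])
  (id : cell d -> {ffun 'I_d -> int} * {set 'I_d}).
move=> /(_ (finite_setX (finite_setD _ finA) finite_finset)).
rewrite (fset_set_cardX (finite_setD _ finA) finite_finset).
rewrite fset_set_setT_card card_set_ord mulnC fset_setD // cardfsD.
have -> : (fset_set A `&` fset_set I)%fset = fset_set I.
  by apply/fsetIidPr; rewrite -fset_set_sub.
move=> H; apply: (proj2 (H _ _)) => //.
move=> c [[rc _] [j [jc cj]]]; split=> //; split.
  move=> l; have := rc l; rewrite /cell_lo /cell_hi.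
  by case: (l \in _) => /=; lia.
by move=> /(_ j); lia.
Qed.

Lemma card_type_ge (S : {set 'I_d}) : #|S| = i ->
  (#|` fset_set I| <=
   #|` [fset e in box_plaquettes i r | (val e).2 == S]%fset|)%N.
Proof.
move=> Si; have dimS a : cell_dim ((a, S) :
  cell d) == i by rewrite /cell_dim Si.
pose F a : plaquette d i := exist _ (a, S) (dimS a).
rewrite -[X in (_ <= #|` X|)%N]set_fsetK.
apply: (proj2 (@fset_set_card_inj _ _ _ _ F _ _ _)).
- exact: finite_fset.
- move=> a aI /=; rewrite !inE /= eqxx andbT; apply/mem_box_plaquettes.
  split=> j; have := aI j; rewrite /cell_lo /cell_hi /=; case: (j \in S) => /=;
    lia.
- by move=> a b _ _ [].
Qed.

(** A side with a >= N + 1 lattice points has a - 2 interior ones, so |I| / |A|, a product of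
    factors 1 - 2/a, is at least 1 - 2d/(N + 1). *)
Lemma card_grid_ratio (N : nat) :
    (forall j, N%:Z <= box_hi r j - box_lo r j) ->
  (N.+1 * #|` fset_set A| <= N.+1 * #|` fset_set I| + 2 * d *
    #|` fset_set A|)%N.
Proof.
move=> NL; pose a j := `|(box_hi r j - box_lo r j + 1)%R|%N.
pose b j := `|(box_hi r j - 1 - (box_lo r j + 1) + 1)%R|%N.
have ab j : a j = (b j).+2 by rewrite /a /b; have := box_ltP r j; lia.
have Na j : (N.+1 <= a j)%N by rewrite /a; have := NL j; lia.
have -> : #|` fset_set A| = (\prod_j a j)%N.
  by apply: (proj2 (grid_card _)) => j; have := box_ltP r j; lia.
have -> : #|` fset_set I| = (\prod_j b j)%N.
  by apply: (proj2 (grid_card _)) => j; have := box_ltP r j; lia.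
rewrite -(ler_nat rat) natrD !natrM !natr_prod.
set pa : rat := \prod_j _; set pb : rat := \prod_j _.
have a0 j : 0 < (a j)%:R :> rat by rewrite ltr0n ab.
have pa0 : 0 < pa by apply: prodr_gt0.
pose u j : rat := (b j)%:R / (a j)%:R.
have u1 j : 1 - u j = 2 / (a j)%:R.
  by rewrite -[X in X - _](divff (lt0r_neq0 (a0 j))) -mulrBl ab -addn2 natrD
    addrAC subrr add0r.
have u01 j : 0 <= u j <= 1.
  apply/andP; split; first by rewrite divr_ge0 ?ler0n.
  by rewrite -subr_ge0 u1; apply: divr_ge0; rewrite ?ler0n // ltW.
have := prod_ge_subsum (index_enum 'I_d) u01.
have -> : \prod_j u j = pb / pa by rewrite prodf_div.
have N0 : 0 < N.+1%:R :> rat by rewrite ltr0n.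
have : \sum_j (1 - u j) <= 2 * d%:R / N.+1%:R.
  apply: (@le_trans _ _ (\sum_(j < d) 2 / N.+1%:R)); last first.
    by rewrite sumr_const card_ord -(mulr_natr (2 / _)) mulrAC.
  apply: ler_sum => j _; rewrite u1 ler_pM2l // lef_pV2 ?posrE //.
  by rewrite ler_nat.
move=> h1 h2; have {h1 h2} : 1 - 2 * d%:R / N.+1%:R <= pb / pa.
  by apply: (le_trans _ h2); rewrite lerD2l lerN2.
rewrite ler_pdivlMr // mulrBl mul1r lerBlDr => h.
have := ler_wpM2l (ltW N0) h; rewrite mulrDr => /le_trans; apply.
by rewrite lerD2l mulrA mulrCA divff ?mulr1 ?gt_eqF.
Qed.

End Counting.

Lemma exhausting_ratio (R : realType) (d i : nat) (r : nat -> box d)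
    (S : {set 'I_d}) (eps : R) : exhausting r -> #|S| = i -> 0 < eps ->
  \forall k \near \oo,
   [/\ (#|` fset_set (boundary_cells i (r k))|%:R <= eps *
     #|` box_plaquettes i (r k)|%:R)%R,
       (0 < #|` box_plaquettes i (r k)|)%N &
       (#|` box_plaquettes i (r k)| <= 2 ^ d.+1 *
        #|` [fset e in box_plaquettes i (r k) | (val e).2 == S]%fset|)%N].
Proof.
move=> exr Si eps0.
(* Write a and b for the numbers of lattice points and of interior points. N >= 4d gives a <= 2b,
   hence (N + 1)(a - b) <= 4 d b; the other term gives 2^d 4d / (N + 1) <= eps. The factor 2^(d+1)
   of the conclusion is 2^d from the direction sets times 2 from a <= 2b. *)
pose N := maxn (4 * d) (Num.truncn ((2 ^+ d * (4 * d)%:R) / eps)).+1.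
near=> k.
have sub : cell_in_box (cube d N) `<=` cell_in_box (r k).
  by near: k; exact: exhausting_box.
have NL j : N%:Z <= box_hi (r k) j - box_lo (r k) j.
  by have := sub_box_lohi sub j; rewrite /=; lia.
have := card_grid_ratio NL; have := card_type_ge (r k) Si.
have := card_boxpl_le i (r k); have := card_boundary_cells_le i (r k).
set a := #|` fset_set (grid (box_lo _) _)|;
  set b := #|` fset_set (grid (fun=> _) _)|.
set n := #|` box_plaquettes _ _|; set nS := #|` [fset e in _ | _]%fset|.
set nb := #|` fset_set (boundary_cells _ _)|.
move=> hb hn hS hN.
have SE : (nS <= n)%N by apply: fsubset_leq_card; apply/fsubsetP => e;
  rewrite !inE => /andP[].
have N4 : (4 * d <= N)%N by rewrite leq_maxl.
have a0 : (0 < a)%N.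
  rewrite /a (proj2 (grid_card _)); last by move=> j; have := box_ltP (r k) j;
    lia.
  by apply: prodn_gt0 => j; have := box_ltP (r k) j; lia.
have a2b : (a <= 2 * b)%N.
  have : (2 * (N.+1 * a) <= 2 * (N.+1 * b) + N * a)%N by nia.
  by nia.
have ab : (N.+1 * (a - b) <= 4 * d * b)%N by nia.
split.
- apply: (@le_trans _ _ (eps * b%:R)); last by rewrite ler_pM2l // ler_nat
  (leq_trans hS).
  have N0 : 0 < N.+1%:R :> R by rewrite ltr0n.
  rewrite -(ler_pM2l N0).
  apply: (@le_trans _ _ ((2 ^+ d * (4 * d)%:R) * b%:R)).
    by rewrite -natrX -!natrM ler_nat; nia.
  rewrite mulrA; apply: ler_wpM2r => //.
  rewrite -ler_pdivrMr //.
  apply: ltW; apply: (lt_le_trans (truncnS_gt _)).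
  by rewrite ler_nat; apply: leqW; apply: leq_maxr.
- by apply: (leq_trans _ SE); apply: (leq_trans _ hS); nia.
- rewrite expnS; nia.
Unshelve. all: by end_near. Qed.

(** * Pressure and edge densities *)

Definition open_at (R : realType) (d i : nat) (e : plaquette d i)
  (w : set (plaquette d i)) : R := (`[< w e >])%:R.

Definition density_gap (R : realType) (d i q : nat) (x : R) (r : box d)
    (e : plaquette d i) : R :=
  mean q x r setT (open_at R e) - mean q x r set0 (open_at R e).

Section Pressure.
Variables (R : realType) (d i q : nat).
Implicit Types (r : box d) (xi : set (plaquette d i)).

Lemma open_at_mono (e : plaquette d i) (w w' : set (plaquette d i)) :
  w `<=` w' -> open_at R e w <= open_at R e w'.
Proof.
move=> ww'; rewrite /open_at ler_nat; case: asboolP => // we.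
by case: asboolP => // nw; exfalso; apply: nw; exact: ww'.
Qed.

Lemma sum_open_at r (P : {fset plaquette d i}) :
  (P `<=` box_plaquettes i r)%fset ->
  \sum_(e <- box_plaquettes i r) open_at R e [set` P] = #|` P|%:R.
Proof.
move=> PE; rewrite -(@big_fset_incl _ _ _ _ P) //; last first.
  by move=> e _ nP; rewrite /open_at asboolF //=; exact/negP.
rewrite (eq_big_seq (fun=> 1)); last by move=> e eP; rewrite /open_at asboolT.
by rewrite big_const_seq count_predT iter_addr_0.
Qed.

(** Jensen's inequality: the ratio of the sums at x e^t and at x is the mean of e^(t |P|), which is
    at least e^(t M) with M the mean of |P|. *)
Lemma ln_rc_sum_tangent (x t : R) r xi : 0 < x ->
  ln (rc_sum q x r xi) + t * \sum_(e <- box_plaquettes i r) mean q x r xi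
    (open_at R e) <=
  ln (rc_sum q (x * expR t) r xi).
Proof.
move=> x0; set M := \sum_(e <- _) _.
have ME : M = mean q x r xi (fun w => \sum_(e <- box_plaquettes i r) open_at R
  e w).
  by rewrite mean_sum.
have xt0 : 0 < x * expR t by rewrite mulr_gt0 ?expR_gt0.
have Z0 := rc_sum_gt0 q r xi x0.
have Zt := rc_sum_gt0 q r xi xt0.
rewrite -lerBrDl -ln_div ?posrE // -[X in X <=
  _]expRK ler_ln ?posrE ?expR_gt0 ?divr_gt0 //.
(* The tangent line to e^(t n) at n = M, evaluated at the number of open plaquettes; its mean is
   e^(t M). *)
pose phi w := expR (t * M) * (1 + t * (\sum_(e <- box_plaquettes i r) open_at R
  e w - M)).
have <- : mean q x r xi phi = expR (t * M).
  rewrite meanZ // meanD // meanZ // meanB // !mean_cst // -ME subrr mulr0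
    addr0 mulr1 //.
rewrite /mean ler_pM2r ?invr_gt0 // /rc_sum big_seq [leRHS]big_seq.
apply: ler_sum => P; rewrite fpowersetE => PE.
rewrite /phi sum_open_at // /rc_weight exprMn -expRM_natl -mulrA -[leRHS]mulrA.
rewrite ler_pM2l ?exprn_gt0 // mulrC ler_wpM2r ?ler0n //.
have -> : #|` P|%:R * t = t * M + t * (#|` P|%:R - M) by rewrite mulrBr [t *
  _%:R]mulrC addrCA subrr addr0.
by rewrite expRD ler_pM2l ?expR_gt0 // expR_ge1Dx.
Qed.

Lemma rc_sum_antimono (x : R) r xi xi' : 0 < x -> xi `<=` xi' ->
  rc_sum q x r xi' <= rc_sum q x r xi.
Proof.
move=> x0 xx; apply: ler_sum => P _; rewrite ler_pM2l ?exprn_gt0 // ler_nat.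
by apply: closed_card_antimono; apply: setUS; apply: setSD.
Qed.

Lemma rc_sum_free_le (x : R) r : 0 < x ->
  rc_sum q x r (@set0 (plaquette d i)) <=
  #|'Z_q|%:R ^+ #|` fset_set (boundary_cells i r)| *
    rc_sum q x r (@setT (plaquette d i)).
Proof.
move=> x0; rewrite /rc_sum mulr_sumr big_seq [leRHS]big_seq.
apply: ler_sum => P; rewrite fpowersetE => PE.
rewrite /rc_weight mulrCA ler_pM2l ?exprn_gt0 // -natrX -natrM ler_nat mulnC
  set0D setU0 setTD.
apply: closed_card_boundary_le => e eP; apply/mem_box_plaquettes;
  exact: (fsubsetP PE).
Qed.

(** Each further plaquette of [xi] is one more constraint on the functions counted, so the sum
    decreases in [xi]. *)
Lemma ln_rc_sum_bound (x : R) r xi : 0 < x ->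
  [/\ ln (rc_sum q x r (@setT (plaquette d i))) <= ln (rc_sum q x r xi),
      ln (rc_sum q x r xi) <= ln (rc_sum q x r (@set0 (plaquette d i))) &
      ln (rc_sum q x r (@set0 (plaquette d i))) <=
        ln (rc_sum q x r (@setT (plaquette d i))) +
        #|` fset_set (boundary_cells i r)|%:R * ln #|'Z_q|%:R].
Proof.
move=> x0; have p0 := fun xi => @rc_sum_gt0 R d i q x r xi x0.
split.
- by rewrite ler_ln ?posrE //; apply: rc_sum_antimono.
- by rewrite ler_ln ?posrE //; apply: rc_sum_antimono.
- have Z0 : 0 < #|'Z_q|%:R :> R by rewrite ltr0n card_ord.
  rewrite addrC mulr_natl -lnXn // -lnM ?posrE ?exprn_gt0 //.
  by rewrite ler_ln ?posrE ?mulr_gt0 ?exprn_gt0 //; exact: rc_sum_free_le.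
Qed.

(** The tangent inequality is used for the wired sum with t and for the free sum with -t. Passing to
    [xi] costs one boundary term for the wired sum at x and one for the free sum at x e^-t, whence
    the factor 2; the other two comparisons are free of cost. *)
Lemma density_gap_sum_le (x t : R) r xi : 0 < x -> 0 < t ->
  t * \sum_(e <- box_plaquettes i r) density_gap q x r e <=
  ln (rc_sum q (x * expR t) r xi) + ln (rc_sum q (x * expR (- t)) r xi)
  - 2 * ln (rc_sum q x r xi) + 2 * (#|` fset_set (boundary_cells i r)|%:R *
    ln #|'Z_q|%:R).
Proof.
move=> x0 t0; rewrite /density_gap sumrB mulrBr.
have := ln_rc_sum_tangent t r setT x0; have :=
  ln_rc_sum_tangent (- t) r set0 x0.
have [] := ln_rc_sum_bound r xi x0.
have [] := ln_rc_sum_bound r xi (mulr_gt0 x0 (expR_gt0 t)).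
have [] := ln_rc_sum_bound r xi (mulr_gt0 x0 (expR_gt0 (- t))).
set b := _ * ln _; rewrite mulNr; lra.
Qed.

End Pressure.

(** * Differentiability in the logarithm of the odds *)

Section Odds.
Variable R : realType.

Definition prob_of_odds (x : R) : R := x / (1 + x).

Lemma prob_of_oddsK (x : R) : 0 < x ->
  0 < prob_of_odds x < 1 /\ prob_of_odds x / (1 - prob_of_odds x) = x.
Proof.
move=> x0; rewrite /prob_of_odds; have x1 : 0 < 1 + x by rewrite addr_gt0.
split; first by rewrite divr_gt0 //= ltr_pdivrMr // mul1r ltrDr.
by field; rewrite addrK oner_neq0 gt_eqF.
Qed.

Lemma odds_of_probK (p : R) : 0 < p < 1 -> prob_of_odds (p / (1 - p)) = p.
Proof.
move=> /andP[p0 p1]; rewrite /prob_of_odds; field.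
by rewrite subrK oner_neq0 subr_eq0 gt_eqF.
Qed.

(** As a function of the logarithm of the odds, f has difference quotients at t and -t that are both
    within c/2 of the same derivative; the second difference is t times their difference. *)
Lemma second_difference (f : R -> R) (p0 c : R) : 0 < p0 < 1 ->
    derivable f p0 1 -> 0 < c ->
  exists t : R, 0 < t /\
    f (prob_of_odds (p0 / (1 - p0) * expR t)) +
    f (prob_of_odds (p0 / (1 - p0) * expR (- t))) - 2 * f p0 < c * t.
Proof.
move=> p01 df c0; set x0 := p0 / (1 - p0).
have x00 : 0 < x0 by exact: odds_gt0.
pose s t := prob_of_odds (x0 * expR t).
have s0 : s 0 = p0 by rewrite /s expR0 mulr1 odds_of_probK.
have ds : derivable s 0 1.
  rewrite /s /prob_of_odds; apply: derivableM => //.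
  apply: derivableV.
    by rewrite gt_eqF // addr_gt0 // mulr_gt0 ?expR_gt0.
  by apply: derivableD => //.
have dg : derivable (f \o s) 0 1.
  apply: ex_derive.
  apply: is_derive1_comp.
    rewrite s0; exact: DeriveDef.
  exact: DeriveDef.
have [D] := (iffLR (cvg_ex _) dg) => /cvgrPdist_lt /(_ (c / 2)).
rewrite divr_gt0 // => /(_ isT); rewrite near_withinE /= =>
  /nbhs_ballP[delta /= delta0 H].
have step h : h != 0 -> `|h| < delta -> `|D - h^-1 * (f (s h) - f p0)| < c / 2.
  move=> h0 hd; have := H h; rewrite /ball /= sub0r normrN => /(_ hd h0).
  by rewrite /= scaler1 addr0 s0.
pose t := delta / 2.
have t0 : 0 < t by rewrite divr_gt0.
have td : `|t| < delta by rewrite gtr0_norm // /t; lra.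
exists t; split => //.
have := step t (lt0r_neq0 t0) td.
have := step (- t); rewrite oppr_eq0 normrN lt0r_neq0 // => /(_ isT td).
rewrite invrN mulNr opprK -/(s _) -/(s _) !ltr_norml => /andP[_ h1] /andP[h2 _].
have E : f (s t) + f (s (- t)) - 2 * f p0 =
  t * (t^-1 * (f (s t) - f p0) + t^-1 * (f (s (- t)) - f p0)).
  by rewrite -mulrDr mulVKf ?lt0r_neq0 //; ring.
by rewrite -/(s t) -/(s (- t)) E mulrC ltr_pM2r //; lra.
Qed.

End Odds.

(** * Monotonicity and translation of the density gap *)

Section Gap.
Variables (R : realType) (d i q : nat) (x : R).
Hypothesis x0 : 0 < x.
Implicit Types (r : box d) (xi : set (plaquette d i)).

Lemma open_at_local (e : plaquette d i) (F : set (plaquette d i)) w :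
  F e -> open_at R e (w `&` F) = open_at R e w.
Proof.
move=> Fe; rewrite /open_at; congr (_%:R); congr (nat_of_bool _).
by apply/asbool_equiv_eq; split=> [[]|].
Qed.

Lemma density_gap_le r r' (e : plaquette d i) :
  cell_in_box r `<=` cell_in_box r' ->
  boxpl r e -> density_gap q x r' e <= density_gap q x r e.
Proof.
move=> rr' re; apply: lerB.
  apply: mean_le_wired => //; first by move=> w w'; exact: open_at_mono.
  by move=> w; exact: open_at_local.
by apply: mean_free_le => // w w'; exact: open_at_mono.
Qed.

Lemma density_gap_ge0 r (e : plaquette d i) : 0 <= density_gap q x r e.
Proof.
rewrite subr_ge0; apply: mean_free_le => // w w'; exact: open_at_mono.
Qed.

Lemma mean_shift (v : 'I_d -> int) r xi phi :
  mean q x (shift_box v r) xi phi =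
  mean q x r (shift_plaq v @^-1` xi) (fun w => phi (shift_plaq v @` w)).
Proof.
pose tau (P : {fset plaquette d i}) := (shift_plaq v @` P)%fset.
have tau_inj : injective (@shift_plaq d i v) by exact: can_inj (shift_plaqK v).
have mem_tau P e : (shift_plaq v e \in tau P) = (e \in P).
  by rewrite mem_imfset.
have mem_box e : (shift_plaq v e \in box_plaquettes i (shift_box v r)) =
    (e \in box_plaquettes i r).
  by apply/idP/idP; rewrite !mem_box_plaquettes shift_boxpl.
have tauI : injective tau.
  by move=> P Q e; apply/fsetP => y; rewrite -mem_tau e mem_tau.
have psE : fpowerset (box_plaquettes i (shift_box v r)) =
    (tau @` fpowerset (box_plaquettes i r))%fset.
  apply/fsetP => P; rewrite fpowersetE; apply/idP/imfsetP => /= [PE|[Q QE ->]].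
    exists (shift_plaq (fun j => - v j) @` P)%fset.
      rewrite fpowersetE; apply/fsubsetP => _ /imfsetP[e /= eP ->].
      by rewrite -mem_box shift_plaqNK; exact: (fsubsetP PE).
    apply/fsetP => e; rewrite -[in RHS](shift_plaqNK v e) mem_tau.
    by rewrite mem_imfset //=; exact: can_inj (shift_plaqNK v).
  rewrite fpowersetE in QE; apply/fsubsetP => _ /imfsetP[e /= eP ->].
  by rewrite mem_box; exact: (fsubsetP QE).
have WE P : rc_weight q x (shift_box v r) xi (tau P) =
  rc_weight q x r (shift_plaq v @^-1` xi) P.
  rewrite /rc_weight card_imfset // closed_card_shift;
    congr (_ * (closed_card q r _)%:R).
  apply/seteqP; split=> e /=; rewrite mem_tau shift_boxpl; tauto.
have sum_tau (F : {fset plaquette d i} -> R) :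
    \sum_(P <- fpowerset (box_plaquettes i (shift_box v r))) F P =
    \sum_(P <- fpowerset (box_plaquettes i r)) F (tau P).
  by rewrite psE big_imfset //= => P Q _ _; exact: tauI.
rewrite /mean /rc_sum !sum_tau; congr (_ / _); last by apply: eq_bigr => P _;
  exact: WE.
apply: eq_bigr => P _; rewrite WE; congr (_ * phi _).
apply/seteqP; split=> e /=; first by move=> /imfsetP[y /= yP ->]; exists y.
by move=> [y yP <-]; rewrite mem_tau.
Qed.

Lemma density_gap_shift (v : 'I_d -> int) r (e : plaquette d i) :
  density_gap q x (shift_box v r) (shift_plaq v e) = density_gap q x r e.
Proof.
have E : (fun w => open_at R (shift_plaq v e) (shift_plaq v @` w)) =
  open_at R e.
  apply/funext => w; rewrite /open_at; congr (_%:R); congr (nat_of_bool _).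
  apply/asbool_equiv_eq; split=> [[e' we' /(can_inj (shift_plaqK v)) <-//]|we].
  by exists e.
by rewrite /density_gap !mean_shift preimage_setT preimage_set0 E.
Qed.

(** A plaquette of [r] with the directions of [e] is a translate of [e], so its gap in [r] is the
    gap of [e] in a translated box, to which the hypothesis applies. The other gaps are
    nonnegative. *)
Lemma density_gap_sum_ge r (e : plaquette d i) (eps : R) :
    (forall s, boxpl s e -> eps <= density_gap q x s e) ->
  eps * #|` [fset e' in box_plaquettes i r | (val e').2 == (val e).2]%fset|%:R
    <=
  \sum_(e' <- box_plaquettes i r) density_gap q x r e'.
Proof.
move=> He; set T := [fset _ in _ | _]%fset.
have TE : (T `<=` box_plaquettes i r)%fset.
  by apply/fsubsetP => e'; rewrite !inE => /andP[].
apply: (@le_trans _ _ (\sum_(e' <- T) eps)).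
  by rewrite big_const_seq count_predT iter_addr_0 mulr_natr.
apply: (@le_trans _ _ (\sum_(e' <- T) if e' \in T then density_gap q x r e'
  else 0)).
  rewrite big_seq [leRHS]big_seq; apply: ler_sum => e' e'T; rewrite e'T.
  have : (val e').2 = (val e).2 by apply/eqP; move: e'T;
    rewrite !inE => /andP[].
  have re' : boxpl r e' by apply/mem_box_plaquettes; exact: (fsubsetP TE).
  move=> e2; pose v j := (val e).1 j - (val e').1 j.
  have ev : shift_plaq v e' = e.
    apply: val_inj; rewrite /= /shift_cell e2 [RHS]surjective_pairing;
      congr pair.
    by apply/ffunP => j; rewrite ffunE /v addrC subrK.
  by rewrite -(density_gap_shift v) ev; apply: He; rewrite -ev;
    apply/shift_boxpl.
rewrite (big_fset_incl _ TE); last by move=> e' _ /negbTE ->.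
by apply: ler_sum => e' _; case: ifP => // _; exact: density_gap_ge0.
Qed.

End Gap.

(** Otherwise the gaps in a large box with n plaquettes add up to at least c n, while the second
    difference of the pressure and the boundary term bound t times this sum by less than c t n, each
    contributing at most half. *)
Lemma density_gap_small (R : realType) (d i q : nat) (f : R -> R) (p0 : R)
    (e : plaquette d i) (eps : R) : (0 < i)%N ->
    limiting_pressure d i q f -> 0 < p0 < 1 -> derivable f p0 1 -> 0 < eps ->
  exists r, boxpl r e /\ density_gap q (p0 / (1 - p0)) r e < eps.
Proof.
move=> i0 [r [xi [exr fr]]] p01 df eps0; set x := p0 / (1 - p0).
have x0 : 0 < x by exact: odds_gt0.
apply: contrapT => nex.
have He s : boxpl s e -> eps <= density_gap q x s e.
  by move=> se; rewrite leNgt; apply/negP => lt; apply: nex; exists s.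
(* At least a fraction 1 / 2^(d+1) of the plaquettes of a large box are parallel to [e]. *)
pose c := eps / 2 ^+ d.+1.
have c0 : 0 < c by rewrite divr_gt0 // exprn_gt0.
have [t [t0 ft]] := @second_difference _ _ _ (c / 2) p01 df (divr_gt0 c0
  (ltr0Sn _ 1)).
have xp s : 0 < x * expR s by rewrite mulr_gt0 ?expR_gt0.
pose lq : R := ln #|'Z_q|%:R.
have lq0 : 0 <= lq by rewrite ln_ge0 // ler1n card_ord.
(* Boundary cells per plaquette: their contribution 2 [dl] [lq] is then at most c t / 2. Adding 1 to
   [lq] keeps the denominator positive. *)
pose dl := (c * t) / (4 * (1 + lq)).
have dl0 : 0 < dl by rewrite divr_gt0 ?mulr_gt0 // ltr_wpDr.
have [pp pE] := prob_of_oddsK (xp t).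
have [pm mE] := prob_of_oddsK (xp (- t)).
pose F k := box_pressure q (prob_of_odds (x * expR t)) (r k) xi +
  box_pressure q (prob_of_odds (x * expR (- t))) (r k) xi -
  2 * box_pressure q p0 (r k) xi.
have cF : F @ \oo --> f (prob_of_odds (x * expR t)) +
    f (prob_of_odds (x * expR (- t))) - 2 * f p0.
  by apply: cvgB; [apply: cvgD|apply: cvgMr]; exact: fr.
have H1 : \forall k \near \oo, F k < c / 2 * t by exact: (cvgr_lt _ cF).
have type_e : #|(val e).2| = i by apply/eqP; exact: (valP e).
have H2 := exhausting_ratio exr type_e dl0.
have [k [Fk [bk nk Sk]]] := @filter_ex _ \oo _ _ (filterI H1 H2).
set n := #|` box_plaquettes i (r k)| in bk nk Sk.
have n0 : 0 < n%:R :> R by rewrite ltr0n.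
have := density_gap_sum_le q (r k) xi x0 t0.
apply/negP; rewrite -ltNge.
have FE : ln (rc_sum q (x * expR t) (r k) xi) + ln (rc_sum q (x *
  expR (- t)) (r k) xi) -
  2 * ln (rc_sum q x (r k) xi) = n%:R * F k.
  rewrite /F !box_pressureE // pE mE -/x -/n.
  set a := ln _; set b := ln _; set u := ln _; set w := ln _.
  by field; rewrite gt_eqF.
rewrite FE -/lq.
have ge := density_gap_sum_ge x0 (r k) He.
have Sk' : n%:R <= 2 ^+ d.+1 * #|` [fset e' in box_plaquettes i (r k) | (val
  e').2 == (val e).2]%fset|%:R :> R.
  by rewrite -natrX -natrM ler_nat.
have ge' : c * n%:R <= \sum_(e' <- box_plaquettes i (r k)) density_gap q x (r
  k) e'.
  apply: le_trans ge; rewrite /c mulrAC ler_pdivrMr ?exprn_gt0 // -mulrA.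
  by rewrite ler_pM2l // mulrC.
have h1 : n%:R * F k < n%:R * (c / 2 * t) by rewrite ltr_pM2l.
have h2 : t * (c * n%:R) <= t * \sum_(e' <- box_plaquettes i (r k)) density_gap
  q x (r k) e'.
  by rewrite ler_pM2l.
have h3 : 2 * (#|` fset_set (boundary_cells i (r k))|%:R * lq) <= 2 * (dl *
  n%:R * lq).
  by rewrite ler_pM2l // ler_wpM2r.
have h4 : 2 * (dl * lq) <= c / 2 * t.
  have -> : 2 * (dl * lq) = (c / 2 * t) * (lq / (1 + lq)).
    by rewrite /dl; field; rewrite gt_eqF // ltr_wpDr.
  rewrite ger_pMr ?mulr_gt0 // ?divr_gt0 // ler_pdivrMr ?mul1r ?lerDr //.
  by rewrite ltr_wpDr.
have h5 : 2 * (dl * n%:R * lq) <= n%:R * (c / 2 * t).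
  have -> : 2 * (dl * n%:R * lq) = n%:R * (2 * (dl * lq)) by ring.
  by rewrite ler_pM2l.
move: h1 h2 h3 h5; lra.
Qed.

(** * Convergence of local events *)

Definition ind (R : realType) (T : Type) (A : set T) (w : T) : R :=
  (`[< A w >])%:R.

Lemma ind01 (R : realType) (T : Type) (A : set T) (w : T) : 0 <= ind R A w <= 1.
Proof. by rewrite /ind; case: asboolP => _; rewrite ?lexx ler01. Qed.

Definition local_on (T : choiceType) (F : {fset T}) (A : set (set T)) : Prop :=
  forall w w' : set T, (forall e, e \in F -> (w e <-> w' e)) -> (A w <-> A w').

(** If the two configurations agree on [F], the indicator does not change; otherwise the sum grows
    by at least 1, which outweighs a change of the second term by at most 1. *)
Lemma sum_open_ind_mono (R : realType) (d i : nat) (F : {fset plaquette d i})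
    (A : set (set (plaquette d i))) (b : R) : local_on F A -> `|b| <= 1 ->
  forall w w', w `<=` w' ->
  \sum_(e <- F) open_at R e w + b * ind R A w <=
  \sum_(e <- F) open_at R e w' + b * ind R A w'.
Proof.
move=> AF b1 w w' ww'.
have le_sum : \sum_(e <- F) open_at R e w <= \sum_(e <- F) open_at R e w'.
  by apply: ler_sum => e _; exact: open_at_mono.
have [same|/existsNP[e /not_implyP[eF ne]]] :=
    pselect (forall e, e \in F -> (w e <-> w' e)).
  by rewrite /ind (asbool_equiv_eq (AF _ _ same)) lerD2r.
have [we w'e] : ~ w e /\ w' e.
  have [we|we] := pselect (w e); first by exfalso; apply: ne; split=> // _;
    exact: ww'.
  by split=> //; apply: contrapT => w'e; apply: ne; split.
have gap1 : \sum_(e <- F) open_at R e w + 1 <= \sum_(e <- F) open_at R e w'.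
  have o0 : open_at R e w = 0 by rewrite /open_at asboolF.
  have o1 : open_at R e w' = 1 by rewrite /open_at asboolT.
  rewrite !(big_fsetD1 e eF) /= o0 o1 add0r [leLHS]addrC lerD2l.
  by apply: ler_sum => e' _; exact: open_at_mono.
have := ind01 R A w; have := ind01 R A w'; move: b1 gap1.
rewrite ler_norml; move: (ind R A w) (ind R A w') =>
  u u' /andP[? ?] ? /andP[? ?] /andP[? ?].
nra.
Qed.

Section LocalLimit.
Variables (R : realType) (d i q : nat) (f : R -> R) (p0 : R).
Hypothesis i0 : (0 < i)%N.
Hypothesis fP : limiting_pressure d i q f.
Hypothesis p01 : 0 < p0 < 1.
Hypothesis df : derivable f p0 1.

Let x := p0 / (1 - p0).
Let x0 : 0 < x. Proof. exact: odds_gt0. Qed.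

Lemma near_density_gap_small (r : nat -> box d) (s :
  seq (plaquette d i)) (eps : R) :
    exhausting r -> 0 < eps ->
  \forall k \near \oo, forall e, e \in s -> boxpl (r k) e /\
    density_gap q x (r k) e < eps.
Proof.
move=> exr eps0; elim: s => [|e s IH]; first by near=> k.
have [re [ee lt]] := density_gap_small e i0 fP p01 df eps0.
near=> k => e'; rewrite inE => /predU1P[->|].
  have sub : cell_in_box re `<=` cell_in_box (r k) by near: k;
    exact: exhausting_box.
  split; first exact: (boxpl_sub sub ee).
  exact: (le_lt_trans (density_gap_le q x0 sub ee) lt).
by move: e'; near: k.
Unshelve. all: by end_near. Qed.

(** The box [r0] depends on [F] and [eps] only, so the estimate is uniform over events, larger boxes
    and boundary conditions. *)
Lemma local_close (F : {fset plaquette d i}) (eps : R) : 0 < eps ->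
  exists r0 : box d, forall r xi A, cell_in_box r0 `<=` cell_in_box r ->
    local_on F A -> `|mean q x r xi (ind R A) - mean q x r0 set0 (ind R A)| <=
      eps.
Proof.
move=> eps0; have [r [xi0 [exr _]]] := fP.
(* The successor covers an empty [F]. *)
pose e1 := eps / (#|` F|.+1)%:R.
have e10 : 0 < e1 by rewrite divr_gt0.
have [k Hk] := @filter_ex _ \oo _ _ (@near_density_gap_small r F e1 exr e10).
exists (r k) => r' xi A sub AF.
have lower b : `|b| <= 1 ->
    \sum_(e <- F) mean q x (r k) set0 (open_at R e) + b *
      mean q x (r k) set0 (ind R A) <=
    \sum_(e <- F) mean q x r' xi (open_at R e) + b * mean q x r' xi (ind R A).
  move=> b1; rewrite -!mean_sum // -!meanZ // -!meanD //.
  by apply: mean_free_le => //; exact: sum_open_ind_mono.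
have upper : \sum_(e <- F) mean q x r' xi (open_at R e) -
    \sum_(e <- F) mean q x (r k) set0 (open_at R e) <= eps.
  rewrite -sumrB; apply: (@le_trans _ _ (\sum_(e <- F) e1)).
    rewrite big_seq [leRHS]big_seq; apply: ler_sum => e eF.
    have [ke lt] := Hk _ eF; apply: (le_trans _ (ltW lt)); rewrite lerD2r.
    apply: mean_le_wired => // [w w'|w]; first exact: open_at_mono.
    exact: open_at_local.
  rewrite big_const_seq count_predT iter_addr_0 -mulr_natr /e1 -mulrA.
  by rewrite ger_pMr // mulrC ler_pdivrMr // mul1r ler_nat.
(* The two signs bound the difference of the probabilities from below and from above. *)
have := lower 1; have := lower (-1); rewrite normrN normr1 =>
  /(_ (lexx _)) h1 /(_ (lexx _)) h2.
rewrite ler_norml; move: h1 h2 upper; lra.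
Qed.

Lemma local_limit : exists L : set (set (plaquette d i)) -> R,
  forall A, local_event A -> forall (r : nat -> box d) xi, exhausting r ->
    (fun k => mean q x (r k) (xi k) (ind R A)) @ \oo --> L A.
Proof.
have [r [_ [exr _]]] := fP.
exists (fun A => lim ((fun k => mean q x (r k) set0 (ind R A)) @ \oo)) =>
  A [F AF] r' xi exr'.
(* One value [a] serves all exhausting sequences and boundary conditions: it yields both the Cauchy
   property along [r] and the agreement of the other limits with that one. *)
have close (eps : R) : 0 < eps ->
    exists a : R, (forall t : nat -> box d, exhausting t -> forall zeta,
      \forall k \near \oo, `|mean q x (t k) (zeta k) (ind R A) - a| <= eps).
  move=> eps0; have [r0 H] := local_close F eps0.
  exists (mean q x r0 set0 (ind R A)) => t ext zeta.
  near=> k; apply: H => //; near: k; exact: exhausting_box.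
have cv : cvg ((fun k => mean q x (r k) set0 (ind R A)) @ \oo).
  apply/cauchy_cvgP/cauchy_exP => eps eps0.
  have [a Ha] := close (eps / 2) (divr_gt0 eps0 (ltr0Sn _ 1)).
  exists a; have := Ha r exr (fun=> set0); apply: filterS => k.
  by rewrite /ball /= distrC => h; apply: (le_lt_trans h); lra.
apply/cvgrPdist_le => eps eps0.
have [a Ha] := close (eps / 2) (divr_gt0 eps0 (ltr0Sn _ 1)).
set l := lim _.
have la : `|l - a| <= eps / 2.
  have := cv; move/cvgrPdist_lt => cvl.
  apply/ler_addgt0Pr => e e0.
  have [k [k1 k2]] := @filter_ex _ \oo _ _ (filterI (cvl _ e0) (Ha r exr (fun=>
    set0))).
  have -> : l - a = (l - mean q x (r k) set0 (ind R A)) +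
    (mean q x (r k) set0 (ind R A) - a).
    by rewrite addrA subrK.
  apply: (le_trans (ler_normD _ _)); rewrite addrC lerD // ltW //.
near=> k.
have h : `|mean q x (r' k) (xi k) (ind R A) - a| <= eps / 2 by near: k;
  exact: Ha.
have -> : l - mean q x (r' k) (xi k) (ind R A) =
  (l - a) - (mean q x (r' k) (xi k) (ind R A) - a) by rewrite opprB addrA subrK.
apply: (le_trans (ler_normB _ _)); move: h la; lra.
Unshelve. all: by end_near. Qed.

End LocalLimit.

(** * Construction of the limiting measure *)

(** The value that additivity forces on the part, inside the cylinder of [w], of an event decided by
    [size w + m] bits. *)
Fixpoint dyadic_val (R : nmodType) (l : seq bool -> R) (a : pred (seq bool))
    (m : nat) (w : seq bool) : R :=
  if m is m'.+1 then dyadic_val l a m' (rcons w false) +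
    dyadic_val l a m' (rcons w true)
  else if a w then l w else 0.

(** Applied twice with the same [l] and [a], to Lebesgue measure on slots and to [L] on cylinders;
    equal right-hand sides identify the two. [good] is the domain of additivity: measurable sets of
    finite measure in one case, local events in the other. *)
Lemma dyadic_valP (V : Type) (R : nmodType) (good : set (set V)) (T : set V ->
  R)
    (K : seq bool -> set V) (l : seq bool -> R) (E : set V) (n : nat)
    (a : pred (seq bool)) :
    T set0 = 0 -> good set0 -> (forall w, good (K w)) ->
    (forall A B, good A -> good B -> A `&` B = set0 ->
      good (A `|` B) /\ T (A `|` B) = T A + T B) ->
    (forall w, K w = K (rcons w false) `|` K (rcons w true)) ->
    (forall w, K (rcons w false) `&` K (rcons w true) = set0) ->
    (forall w, T (K w) = l w) ->
    (forall w, size w = n -> a w -> K w `<=` E) ->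
    (forall w, size w = n -> ~~ a w -> E `&` K w = set0) ->
  forall m w, (size w + m)%N = n -> good (E `&` K w) /\
    T (E `&` K w) = dyadic_val l a m w.
Proof.
move=> T0 g0 gK Tadd KU KI TK aE naE; elim=> [|m IH] w /= wn.
  rewrite addn0 in wn; case: ifPn => aw; last by rewrite naE.
  by rewrite (_ : E `&` K w = K w) //; apply/setIidPr; exact: aE.
rewrite KU setIUr.
have [|g1 e1] := IH (rcons w false); first by rewrite size_rcons addSnnS.
have [|g2 e2] := IH (rcons w true); first by rewrite size_rcons addSnnS.
have dis : (E `&` K (rcons w false)) `&` (E `&` K (rcons w true)) = set0.
  by rewrite setIACA KI setI0.
by have [g e] := Tadd _ _ g1 g2 dis; rewrite e e1 e2.
Qed.

Section UnitInterval.
Variable R : realType.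

Let mI : measurable (`[0, 1[%classic : set (measurableTypeR R)).
Proof. exact: measurable_itv. Qed.

Definition unit_lebesgue := mrestr (@lebesgue_measure R) mI.

HB.instance Definition _ := Measure.on unit_lebesgue.

Let unit_lebesgueT : unit_lebesgue setT = 1%E.
Proof.
by rewrite /unit_lebesgue /mrestr setTI lebesgue_measure_itv /= lte_fin ltr01
  oppr0 adde0.
Qed.

HB.instance Definition _ := Measure_isProbability.Build _ _ _ unit_lebesgue
  unit_lebesgueT.

End UnitInterval.

(* Nested intervals of lengths l w, subdividing [0, 1[ along the prefix order,
   turn a uniform point u into a random sequence of bits with law l. *)
Section Words.
Variables (R : realType) (l : seq bool -> R).
Hypothesis l_ge0 : forall w, 0 <= l w.
Hypothesis l_nil : l [::] = 1.
Hypothesis l_rcons : forall w, l w = l (rcons w false) + l (rcons w true).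

(** Left endpoint of the interval of [w]: every bit [true] skips the sibling interval with bit
    [false], which lies to its left. *)
Definition slot_lo (w : seq bool) : R :=
  \sum_(m < size w) if nth false w m then l (rcons (take m w) false) else 0.

Lemma slot_lo_nil : slot_lo [::] = 0. Proof. by rewrite /slot_lo big_ord0. Qed.

Lemma slot_lo_rcons w b : slot_lo (rcons w b) = slot_lo w +
  if b then l (rcons w false) else 0.
Proof.
rewrite /slot_lo size_rcons big_ord_recr /= nth_rcons ltnn eqxx -{3}cats1
  take_size_cat //.
congr (_ + _); apply: eq_bigr => m _; rewrite nth_rcons ltn_ord.
by rewrite -(cats1 w b) takel_cat // ltnW.
Qed.

Definition slot (w : seq bool) : set R := `[slot_lo w, slot_lo w + l w[%classic.

Fixpoint word (n : nat) (u : R) : seq bool :=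
  if n is m.+1 then rcons (word m u) (slot_lo (word m u) +
    l (rcons (word m u) false) <= u)
  else [::].

Lemma slotU w : slot w = slot (rcons w false) `|` slot (rcons w true).
Proof.
have := l_ge0 (rcons w false); have := l_ge0 (rcons w true); have := l_rcons w.
rewrite /slot !slot_lo_rcons addr0 => e h1 h0.
apply/seteqP; split=> u; rewrite /= !in_itv /= => h.
  by have [h'|h'] := ltP u (slot_lo w + l (rcons w false)); [left|right]; lra.
by case: h; lra.
Qed.

Lemma slotI w : slot (rcons w false) `&` slot (rcons w true) = set0.
Proof.
rewrite /slot !slot_lo_rcons addr0; apply/seteqP; split=> u //=;
  rewrite !in_itv /=; lra.
Qed.

Lemma size_word n u : size (word n u) = n.
Proof. by elim: n => //= n IH; rewrite size_rcons IH. Qed.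

Lemma slot_word w u : slot w u -> word (size w) u = w.
Proof.
elim/last_ind: w => // w b IH wu.
have wu' : slot w u by rewrite slotU; case: b wu => wu; [right|left].
rewrite size_rcons /= IH //; congr rcons.
move: wu; rewrite /slot slot_lo_rcons /= in_itv /=; case: b;
  rewrite ?addr0 => /andP[h1 h2] //.
by apply/negbTE; rewrite -ltNge.
Qed.

Lemma take_word m n u : (m <= n)%N -> take m (word n u) = word m u.
Proof.
elim: n => [|n IH]; first by rewrite leqn0 => /eqP ->.
rewrite leq_eqVlt => /predU1P[->|mn]; first by rewrite take_oversize //
  size_word.
by rewrite /= -cats1 takel_cat ?size_word // IH.
Qed.

(** Stated for all real functions [g] of the word, so that the induction hypothesis applies to the
    splitting point as well as to both branches. *)
Lemma measurable_word (g : seq bool -> R) n :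
  measurable_fun setT (fun u : measurableTypeR R => g (word n u)).
Proof.
elim: n g => [|n IH] g /=; first exact: measurable_cst.
rewrite (_ : (fun u => _) = (fun u => if slot_lo (word n u) +
  l (rcons (word n u) false) <= u
   then g (rcons (word n u) true) else g (rcons (word n u) false))); last first.
  by apply/funext => u; case: (_ <= u).
apply: measurable_fun_ifT.
- apply: measurable_fun_ler; last exact: measurable_id.
  exact: (IH (fun w => slot_lo w + l (rcons w false))).
- exact: (IH (fun w => g (rcons w true))).
- exact: (IH (fun w => g (rcons w false))).
Qed.

Lemma lebesgue_slot w : lebesgue_measure (slot w) = (l w)%:E.
Proof.
rewrite /slot lebesgue_measure_itv /= lte_fin ltrDl -EFinB addrAC subrr add0r.
case: ifPn => //; rewrite -leNgt => h; congr EFin.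
by apply/eqP; rewrite eq_le h l_ge0.
Qed.

Variables (d i : nat).

(** A plaquette reads the bit whose index is its code in the countable type of plaquettes; the
    successor makes the word just long enough to contain that bit. *)
Definition slot_config (u : measurableTypeR R) : config d i :=
  [set e : plaquette d i | nth false (word (choice.pickle e).+1 u)
    (choice.pickle e)].

Lemma measurable_slot_config : measurable_fun setT slot_config.
Proof.
apply: (@measurability _ _ (measurableTypeR R) (config d i) setT slot_config
  (@open_events d i)) => //.
move=> _ [_ [e ->] <-]; rewrite setTI.
pose k := choice.pickle e.
have -> : slot_config @^-1` [set w | w e] =
    (fun u : measurableTypeR R => (nth false (word k.+1 u) k)%:R :
      R) @^-1` `]0, +oo[%classic.
  apply/seteqP; split=> u; rewrite /slot_config /= in_itv /= andbT ltr0n -/k;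
    by case: nth.
have m := measurable_word (fun w => (nth false w k)%:R) k.+1.
by rewrite -[X in measurable X]setTI; apply: m => //; exact: measurable_itv.
Qed.

HB.instance Definition _ := isMeasurableFun.Build _ _ _ _ slot_config
  measurable_slot_config.

Definition slot_prob := distribution (@unit_lebesgue R) slot_config.

End Words.

Lemma finite_set_ltn (T : choiceType) (f : T -> nat) (n : nat) :
  injective f -> finite_set [set e | (f e < n)%N].
Proof.
move=> finj; apply: (proj1 (@fset_set_card_inj _ _ _ `I_n f _ _ _)) => //.
by move=> e e' _ _; exact: finj.
Qed.

(** * Local events and cylinders *)

Section LocalEvents.
Variables d i : nat.
Implicit Types A B : set (set (plaquette d i)).

Lemma local_event0 : @local_event d i set0.
Proof. by exists fset0. Qed.

Lemma local_eventT : @local_event d i setT.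
Proof. by exists fset0. Qed.

Lemma local_eventU A B : local_event A -> local_event B ->
  local_event (A `|` B).
Proof.
move=> [F AF] [G BG]; exists (F `|` G)%fset => w w' ww'.
have /AF eA : forall e, e \in F -> (w e <-> w' e) by move=> e eF; apply: ww';
  rewrite inE eF.
have /BG eB : forall e, e \in G -> (w e <-> w' e).
  by move=> e eG; apply: ww'; rewrite inE eG orbT.
rewrite /setU /=; tauto.
Qed.

Lemma local_eventI A B : local_event A -> local_event B ->
  local_event (A `&` B).
Proof.
move=> [F AF] [G BG]; exists (F `|` G)%fset => w w' ww'.
have /AF eA : forall e, e \in F -> (w e <-> w' e) by move=> e eF; apply: ww';
  rewrite inE eF.
have /BG eB : forall e, e \in G -> (w e <-> w' e).
  by move=> e eG; apply: ww'; rewrite inE eG orbT.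
rewrite /setI /=; tauto.
Qed.

(* An index that codes no plaquette counts as closed. *)
Definition code_open (w : set (plaquette d i)) (m : nat) : Prop :=
  exists2 e, choice.pickle e = m & w e.

(** The cylinder is empty when [s] has a bit [true] at an index coding no plaquette; every cylinder
    thus splits in two at every index, in step with the slots. *)
Definition cyl (s : seq bool) : set (set (plaquette d i)) :=
  [set w | forall m, (m < size s)%N -> (code_open w m <-> nth false s m)].

Lemma code_pickle w e : code_open w (choice.pickle e) <-> w e.
Proof.
split=> [[e' ee' we']|we]; last by exists e.
by rewrite -(pcan_inj choice.pickleK ee').
Qed.

Lemma local_cyl s : local_event (cyl s).
Proof.
have finS := finite_set_ltn (size s) (pcan_inj (@choice.pickleK (plaquette d
  i))).
exists (fset_set [set e : plaquette d i | (choice.pickle e < size s)%N]) =>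
  w w' ww'.
have E m : (m < size s)%N -> (code_open w m <-> code_open w' m).
  move=> ms; split=> -[e em we]; exists e => //; apply/(ww' e) => //;
    by rewrite in_fset_set // inE /= em.
by split=> h m ms; rewrite -(h m ms) -?E // E.
Qed.

Lemma cyl_rcons s b w : cyl (rcons s b) w <-> cyl s w /\
  (code_open w (size s) <-> b).
Proof.
rewrite /cyl /= size_rcons; split=> [h|[h hb] m].
  split=> [m ms|]; first by have := h m (ltnW ms); rewrite nth_rcons ms.
  by have := h (size s) (leqnn _); rewrite nth_rcons ltnn eqxx.
rewrite ltnS leq_eqVlt nth_rcons => /predU1P[->|ms]; first by rewrite ltnn eqxx.
by rewrite ms; exact: h.
Qed.

Lemma cylU s : cyl s = cyl (rcons s false) `|` cyl (rcons s true).
Proof.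
apply/seteqP; split=> w; last by case=> /cyl_rcons[].
move=> sw; have [c|c] := pselect (code_open w (size s)).
  by right; apply/cyl_rcons.
by left; apply/cyl_rcons.
Qed.

Lemma cylI s : cyl (rcons s false) `&` cyl (rcons s true) = set0.
Proof.
by apply/seteqP; split=> w // -[/cyl_rcons[_ h1] /cyl_rcons[_ h2]];
  have := h1.1 (h2.2 isT).
Qed.

End LocalEvents.

Section Extension.
Variables (R : realType) (d i : nat) (L : set (set (plaquette d i)) -> R).
Hypothesis L_ge0 : forall A, local_event A -> 0 <= L A.
Hypothesis L_setT : L setT = 1.
Hypothesis L_add : forall A B, local_event A -> local_event B ->
  A `&` B = set0 -> L (A `|` B) = L A + L B.

Let l (s : seq bool) : R := L (cyl s).

Let l_ge0 s : 0 <= l s. Proof. exact/L_ge0/local_cyl. Qed.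

Let cyl_nil : @cyl d i [::] = setT.
Proof. by apply/seteqP; split. Qed.

Let l_nil : l [::] = 1. Proof. by rewrite /l cyl_nil. Qed.

Let l_rcons s : l s = l (rcons s false) + l (rcons s true).
Proof.
by rewrite /l cylU L_add ?cylI //; exact: local_cyl.
Qed.

Let L0 : L set0 = 0.
Proof.
have := L_add (@local_event0 d i) (@local_event0 d i) (setI0 _).
rewrite setU0; lra.
Qed.

(** The law of [slot_config] when slot lengths are the values of [L] on cylinders. Finite additivity
    of [L] makes the lengths consistent, and both sides are then determined by these lengths. *)
Lemma local_extension : exists mu : probability (config d i) R,
  forall A, local_event A -> mu A = (L A)%:E.
Proof.
exists (@slot_prob R l d i) => A [F AF].
pose n := (\max_(e <- F) choice.pickle e).+1.
have Fn e : e \in F -> (choice.pickle e < n)%N.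
  by move=> eF; rewrite ltnS; apply: leq_bigmax_seq.
pose S s : set (plaquette d i) := [set e | nth false s (choice.pickle e)].
pose a s := `[< A (S s) >].
have cylA s w : size s = n -> cyl s w -> (A w <-> A (S s)).
  move=> sn sw; apply: AF => e eF; rewrite -code_pickle /S /=.
  by apply: sw; rewrite sn; exact: Fn.
have slotA s u : size s = n -> slot l s u -> (A (@slot_config R l d i u) <->
  A (S s)).
  move=> sn /(slot_word l_ge0 l_rcons); rewrite sn => us.
  apply: AF => e eF; pose k := choice.pickle e.
  change (nth false (word l k.+1 u) k <-> nth false s k).
  by rewrite -(take_word l u (Fn _ eF)) us nth_take.
have mslot s : measurable (slot l s : set (measurableTypeR R)) by exact:
  measurable_itv.
pose good (B : set (measurableTypeR R)) := measurable B /\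
  (lebesgue_measure B < +oo)%E.
have H1 := @dyadic_valP _ R good (fun B => fine (lebesgue_measure B)) (slot l) l
  (@slot_config R l d i @^-1` A) n a.
have [||s|B C|s|s|s|s|s|gE E1] := H1 _ _ _ _ _ _ _ _ _ n [::] (add0n n).
- by rewrite measure0.
- by split=> //; rewrite measure0.
- by split=> //; rewrite lebesgue_slot // ltry.
- move=> [mB fB] [mC fC] BC; rewrite /good measureU //; split.
    by split; [exact: measurableU|rewrite lte_add_pinfty].
  by rewrite fineD // ge0_fin_numE.
- exact: slotU.
- exact: slotI.
- by rewrite lebesgue_slot.
- by move=> sn /asboolP As u us; apply/(slotA _ _ sn us).
- move=> sn /asboolPn nAs; apply/seteqP; split=> u // -[Au us].
  by apply: nAs; apply/(slotA _ _ sn us).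
have H2 := @dyadic_valP _ R (@local_event d i) L (@cyl d i) l A n a.
have [||s|B C lB lC BC|s|s|s|s|s|_ E2] :=
  H2 _ _ _ _ _ _ _ _ _ n [::] (add0n n) => //.
- exact: local_event0.
- exact: local_cyl.
- by split; [exact: local_eventU|exact: L_add].
- exact: cylU.
- exact: cylI.
- by move=> sn /asboolP As w ws; apply/(cylA _ _ sn ws).
- move=> sn /asboolPn nAs; apply/seteqP; split=> w // -[Aw ws].
  by apply: nAs; apply/(cylA _ _ sn ws).
rewrite cyl_nil setIT in E2.
rewrite E2 -E1 fineK; last by rewrite ge0_fin_numE //; case: gE.
by rewrite /slot_prob /distribution /pushforward /= /unit_lebesgue /mrestr
  /slot slot_lo_nil add0r l_nil.
Qed.

End Extension.

(** Measurable local events are stable under intersection and generate the sigma-algebra, since each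
    generator depends on a single plaquette. *)
Lemma local_events_unique (R : realType) (d i : nat)
    (mu nu : probability (config d i) R) :
    (forall A, local_event A -> mu A = nu A) ->
  forall A : set (config d i), measurable A -> mu A = nu A.
Proof.
move=> E A mA.
pose G := [set B : set (config d i) | measurable B /\ local_event B].
have GE : @measurable _ (config d i) = <<s G >>.
  apply/seteqP; split=> B.
    apply: sub_smallest2r => // C [e ->]; split.
      by apply: sub_sigma_algebra; exists e.
    by exists [fset e]%fset => w w' ww'; apply: ww'; rewrite inE.
  by apply: smallest_sub => [|C []//]; exact: sigma_algebra_measurable.
apply: (measure_unique G (fun=> setT)) => //.
- by move=> B C [mB lB] [mC lC]; split;
  [exact: measurableI|exact: local_eventI].
- by move=> _; split=> //; exact: local_eventT.
- by rewrite bigcup_const //; exists 0%N.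
- by move=> B [_ lB]; exact: E.
- by move=> _; rewrite /= probability_setT ltry.
Qed.

Theorem theorem23 (R : realType) (d i q : nat) (hi : (1 <= i <= d)%N)
    (hq : (2 <= q)%N) (f : R -> R) (hf : limiting_pressure d i q f)
    (p0 : R) (hp0 : 0 < p0 < 1) (hdiff : derivable f p0 1) :
  exists mu : probability (config d i) R,
    infinite_volume_prc q p0 mu /\
    forall nu : probability (config d i) R, infinite_volume_prc q p0 nu ->
      forall A : set (config d i), measurable A -> nu A = mu A.
Proof.
have i0 : (0 < i)%N by case/andP: hi.
have x0 := odds_gt0 hp0.
have [L LP] := local_limit i0 hf hp0 hdiff.
have [r [_ [exr _]]] := hf.
(* The free measures along the sequence provided by [hf] suffice to pass positivity, total mass and
   additivity to the limit; the same sequence later witnesses that [mu] is an infinite volume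
   measure. *)
have L_cvg A : local_event A ->
    (fun k => mean q (p0 / (1 - p0)) (r k) set0 (ind R A)) @ \oo --> L A.
  by move=> lA; exact: (LP A lA r (fun=> set0) exr).
have L_ge0 A : local_event A -> 0 <= L A.
  move=> lA; rewrite -(cvg_lim _ (L_cvg A lA)) //.
  apply: limr_ge; first by apply/cvg_ex; exists (L A); exact: L_cvg.
  by near=> k; apply: mean_ge0 => // w; case/andP: (ind01 R A w).
have L_setT : L setT = 1.
  rewrite -(cvg_lim _ (L_cvg _ (@local_eventT d i))) //.
  apply: cvg_lim => //; apply: cvg_near_cst; near=> k.
  rewrite -[RHS](mean_cst q x0 (r k) (@set0 (plaquette d i)) 1); congr mean.
  by apply/funext => w; rewrite /ind asboolT.
have L_add A B : local_event A -> local_event B -> A `&` B = set0 ->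
    L (A `|` B) = L A + L B.
  move=> lA lB AB; apply: (cvg_unique _ (L_cvg _ (local_eventU lA lB))) => //.
  rewrite (_ : (fun k => _) = (fun k =>
    mean q (p0 / (1 - p0)) (r k) set0 (ind R A) +
     mean q (p0 / (1 - p0)) (r k) set0 (ind R B))).
    by apply: cvgD; exact: L_cvg.
  apply/funext => k; rewrite -meanD //; congr mean; apply/funext => w;
    rewrite /ind.
  have [Aw|nAw] := pselect (A w).
    rewrite asboolT; last by left.
    rewrite asboolT // asboolF ?addr0 // => Bw.
    by have : (A `&` B) w by []; rewrite AB.
  rewrite [in X in _ = X + _]asboolF // add0r; congr (nat_of_bool _)%:R.
  by apply/asbool_equiv_eq; split=> [[]|] //; right.
have [mu muL] := local_extension L_ge0 L_setT L_add.
have probE r' (xi : nat -> set (plaquette d i)) A :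
    (fun k => (prc_prob q p0 (r' k) (xi k) A)%:E) =
    EFin \o (fun k => mean q (p0 / (1 - p0)) (r' k) (xi k) (ind R A)).
  by apply/funext => k /=; rewrite prc_probE.
exists mu; split.
  exists r, (fun=> set0); split=> // A lA.
  by rewrite muL // probE; apply/fine_cvgP; split; [near=> k|exact: L_cvg].
move=> nu [r' [xi [exr' nuP]]]; apply: local_events_unique => A lA.
apply: (cvg_unique _ (nuP A lA)) => //.
rewrite muL // probE; apply/fine_cvgP; split; [near=> k => //|exact: LP].
Unshelve. all: by end_near. Qed.
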